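(* Let $A:l^2(\mathbb{Z})\to l^2(\mathbb{Z})$ be the discrete free Schr\''odinger operator $(Au)(k)=u(k-1)+u(k+1)$, $u\in l^2(\mathbb{Z})$, $k\in\mathbb{Z}$. For any $\gamma<1$ there exists a rank-one (bounded linear) operator $M$ on $l^2(\mathbb{Z})$ such that the eigenvalues of $B=A+M$ satisfy $$\sum_{\lambda\in\sigma_{disc}(B)}\frac{\operatorname{dist}(\lambda,[-2,2])^\gamma}{|\lambda+2|^{\frac{\gamma}{2}}|\lambda-2|^{\frac{\gamma}{2}}}=+\infty.$$
   Context: The spectrum of $A$ is $[-2,2]$. $\sigma_{disc}(B)$ is the set of eigenvalues of $B$ that have finite algebraic multiplicity and are isolated from the rest of the spectrum. In the sum each eigenvalue is counted according to its algebraic multiplicity. The space $l^2(\mathbb{Z})$ is complex, and $M$ is not required to be selfadjoint. *)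

(* Defs.v *)
From HB Require Import structures.
From mathcomp Require Import all_boot all_order all_algebra.
From mathcomp Require Import complex ring.
From mathcomp Require Import all_classical all_reals all_analysis.

Set Implicit Arguments.
Unset Strict Implicit.
Unset Printing Implicit Defensive.

Import Order.TTheory GRing.Theory Num.Theory.
(* normc : R[i] -> R is the R-valued modulus; `|z| would be R[i]-valued. *)
Export Normc.

Local Open Scope classical_set_scope.
Local Open Scope ring_scope.
Local Open Scope complex_scope.

Section SquareSummable.
Context {R : realType}.
Implicit Types (u v : int -> R[i]) (f : int -> R).

Definition square_summable : {pred int -> R[i]} :=
  fun u => (\esum_(k in [set: int]) ((normc (u k)) ^+ 2)%:E < +oo)%E.

Lemma esum_ltyZ (c : R) f : 0 <= c -> (forall k, 0 <= f k) ->
  (\esum_(k in [set: int]) (f k)%:E < +oo)%E ->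
  (\esum_(k in [set: int]) (c * f k)%:E < +oo)%E.
Proof.
move=> c0 f0 sf.
apply: (@le_lt_trans _ _ (c%:E * \esum_(k in [set: int]) (f k)%:E)%E).
  apply: ge_ereal_sup => _ [F FT <-].
  under eq_fsbigr do rewrite EFinM.
  rewrite -ge0_mule_fsumr; last by move=> k; rewrite lee_fin.
  apply: lee_pmul => //.
    by apply: fsume_ge0 => k _; rewrite lee_fin.
  by apply: ereal_sup_ubound; exists F.
by rewrite lte_mul_pinfty.
Qed.

Lemma square_summable_submod : submod_closed square_summable.
Proof.
split.
  rewrite /square_summable unfold_in esum1// => k _.
  by rewrite normc0 expr0n.
move=> a u v; rewrite !unfold_in => su sv.
have nge0 (z : R[i]) : 0 <= normc z by case: z => x y; exact: sqrtr_ge0.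
have sqge0 w k : 0 <= normc (w k) ^+ 2 :> R by exact: sqr_ge0.
have le_uv k : normc ((a *: u + v) k) ^+ 2 <=
    2 * normc a ^+ 2 * normc (u k) ^+ 2 + 2 * normc (v k) ^+ 2.
  have ? : normc ((a *: u + v) k) <= normc a * normc (u k) + normc (v k).
    by rewrite -normcM; exact: le_normcD.
  have : 0 <= (normc a * normc (u k) - normc (v k)) ^+ 2 by exact: sqr_ge0.
  have : normc ((a *: u + v) k) ^+ 2 <=
      (normc a * normc (u k) + normc (v k)) ^+ 2.
    by rewrite ler_sqr// nnegrE ?addr_ge0 ?mulr_ge0.
  rewrite sqrrD sqrrB exprMn => h1 h2.
  apply: le_trans h1 _; rewrite -subr_ge0; apply: le_trans h2 _.
  by rewrite le_eqVlt; apply/orP; left; apply/eqP; ring.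
apply: (@le_lt_trans _ _ (\esum_(k in [set: int])
    ((2 * normc a ^+ 2 * normc (u k) ^+ 2)%:E + (2 * normc (v k) ^+ 2)%:E))%E).
  by apply: le_esum => k _; rewrite -EFinD lee_fin.
rewrite esumD; [|by move=> k _; rewrite lee_fin ?mulr_ge0 ..].
by apply: lte_add_pinfty; apply: esum_ltyZ; rewrite ?mulr_ge0.
Qed.

HB.instance Definition _ :=
  GRing.isSubmodClosed.Build R[i] (int -> R[i]) square_summable
    square_summable_submod.

Lemma square_summable_shift (j : int) u :
  u \in square_summable -> (fun k => u (k + j)) \in square_summable.
Proof.
rewrite !unfold_in => su.
rewrite -(@reindex_esum _ _ _ [set: int] [set: int] (fun k => k + j)
  (fun k => ((normc (u k)) ^+ 2)%:E))//.
by split=> // [k k' _ _ /addIr|k _]//; exists (k - j) => //; rewrite subrK.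
Qed.

End SquareSummable.

Record l2 (R : realType) := L2 {
  l2_fun :> int -> R[i];
  l2_square_summable : l2_fun \in square_summable }.

HB.instance Definition _ (R : realType) := [isSub for @l2_fun R].
HB.instance Definition _ (R : realType) := [Choice of l2 R by <:].
HB.instance Definition _ (R : realType) :=
  [SubChoice_isSubLmodule of l2 R by <:].

Definition has_dim (K : fieldType) (V : lmodType K) (E : set V) (n : nat) :=
  exists e : 'I_n -> V,
    (forall c : 'I_n -> K, \sum_i c i *: e i = 0 -> forall i, c i = 0) /\
    E = [set \sum_i c i *: e i | c in [set: 'I_n -> K]].

Section Operators.
Context {R : realType}.
Implicit Types (T S : {linear l2 R -> l2 R}) (l m : R[i]).

Definition l2norm (u : l2 R) : R :=
  Num.sqrt (fine (\esum_(k in [set: int]) ((normc (u k)) ^+ 2)%:E)).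

Definition bounded_op (T : l2 R -> l2 R) :=
  exists c : R, forall u, l2norm (T u) <= c * l2norm u.

Definition rank_one (T : l2 R -> l2 R) := has_dim (range T) 1.

Definition resolvent_set T : set (R[i]) :=
  [set l | exists S, [/\ bounded_op S,
    forall u, S (T u - l *: u) = u & forall u, T (S u) - l *: S u = u]].

Definition spectrum T : set (R[i]) := ~` resolvent_set T.

Definition is_eigenvalue T l := exists u, u != 0 /\ T u = l *: u.

(* The union of the kernels of (T - l)^n. For a finite-rank perturbation of
   the free operator and l isolated in the spectrum, it is the range of the
   Riesz projection at l. *)
Definition root_space T l : set (l2 R) :=
  [set u | exists n, iter n (fun v => T v - l *: v) u = 0].

(* The dimension of the root subspace; the default value 0 is used only when
   that dimension is infinite. *)
Definition alg_mult T l : nat := xget 0%N [set n | has_dim (root_space T l) n].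

Definition isolated_in_spectrum T l :=
  exists2 r : R, 0 < r &
    forall m, spectrum T m -> normc (m - l) < r -> m = l.

Definition discrete_spectrum T : set (R[i]) :=
  [set l | [/\ is_eigenvalue T l,
    exists n, has_dim (root_space T l) n & isolated_in_spectrum T l]].

End Operators.

Section FreeSchrodinger.
Context {R : realType}.

Lemma free_schrodinger_subproof (u : l2 R) :
  (fun k => u (k - 1) + u (k + 1)) \in @square_summable R.
Proof. by apply: rpredD; apply: square_summable_shift; case: u. Qed.

Definition free_schrodinger (u : l2 R) : l2 R :=
  L2 (free_schrodinger_subproof u).

Lemma free_schrodinger_is_linear : linear free_schrodinger.
Proof.
move=> a u v; apply/val_inj/funext => k /=.
by rewrite !fctE /= scalerDr addrACA.
Qed.

HB.instance Definition _ := GRing.isLinear.Build R[i] (l2 R) (l2 R) _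
  free_schrodinger free_schrodinger_is_linear.

End FreeSchrodinger.

Definition dist_segment (R : realType) (l : R[i]) : R :=
  inf [set normc (l - x%:C) | x in `[(-2 : R), 2]].

(* Main.v *)
Require Import Defs.
From HB Require Import structures.
From mathcomp Require Import all_boot all_order all_algebra finmap.
From mathcomp Require Import complex ring lra zify.
From mathcomp Require Import all_classical all_reals all_analysis.

Import Order.TTheory GRing.Theory Num.Theory.
Import numFieldNormedType.Exports.

Local Open Scope classical_set_scope.
Local Open Scope ring_scope.
Local Open Scope complex_scope.

(** Outside [-2, 2] every point is l = w + 1/w with 0 < |w| < 1.  The equation
(A - l) g = delta0 then has in l2 the unique solution
g(k) = w^|k| / (w - 1/w).  Perturb A by M u = ell(u) delta0, where ell is the
functional u |-> \sum_(k >= 0) b_k u(k): the point l is an eigenvalue of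
A + M exactly when 1 + ell(g) = 0, and
  (w^2 - 1) (1 + ell(g)) = w^2 - 1 + w \sum_(k >= 0) b_k w^k.
When b runs over l2, the right-hand side runs over all power series with
square-summable coefficients and constant term -1.  The eigenvalues can
therefore be prescribed as the zeros of any function of the Hardy space H^2 of
the disc which does not vanish at 0.  Take a Blaschke product with real zeros
a_j = 1 - d_j in (0, 1): the only constraint is \sum_j d_j < oo.  At the
eigenvalue a_j + 1/a_j the summand of the theorem is
((1 - a_j) / (1 + a_j))^gamma, which is comparable to d_j^gamma; and as
gamma < 1 one can choose a summable d for which \sum_j d_j^gamma diverges like
the harmonic series ([critical_sequence], [weight_ge]).

On the operator side, A - l is - w^-1 (1 - w S) (1 - w S^-1) with S the unit
shift, and each factor is inverted by a geometric series; this gives a bounded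
inverse of A - l together with an a priori bound ([free_resolvent_surj],
[free_resolvent_le]), from which the resolvent of the rank-one perturbation
follows by the usual explicit formula ([perturbed_resolvent]).  If l is
a zero of order one of 1 + ell(g), it is isolated in the spectrum because
1 + ell(g) does not vanish nearby, and its root space is the line spanned by
g: the next vector in a Jordan chain would make the derivative of 1 + ell(g)
vanish at l ([green_perturbation], [root_space_span],
[simple_zero_eigenvalue]).

On the function side, the Blaschke product is built from its Taylor
coefficients.  Multiplication by a factor (a - z) / (1 - a z) acts on
coefficient sequences by a two-term recursion, and a conserved energy shows
that it does not increase the sums of squares ([blaschke_energy]).  It changes
the n-th coefficient by at most (1 - a) (1 + 2n), so the coefficients of the
finite products converge.  The limit has its zeros exactly where it should and
of order one, because near a given point the finite products with the factors
vanishing there left out are bounded below ([blaschke_product_ge]). *)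

Set Implicit Arguments.
Unset Strict Implicit.
Unset Printing Implicit Defensive.

(** * The modulus of a complex number *)
Section Modulus.
Context {R : realType}.
Implicit Types (x y z : R[i]) (r : R).

Lemma normc_ge0 z : 0 <= normc z.
Proof. by case: z => a b; exact: sqrtr_ge0. Qed.

Lemma normc_eq0 z : (normc z == 0) = (z == 0).
Proof.
by apply/eqP/eqP => [/eq0_normc|->] //; exact: normc0.
Qed.

Lemma normc_gt0 z : (0 < normc z) = (z != 0).
Proof. by rewrite lt_neqAle normc_ge0 andbT eq_sym normc_eq0. Qed.

Lemma normc_add x y : normc (x + y) <= normc x + normc y.
Proof. exact: le_normcD. Qed.

Lemma normc_opp x : normc (- x) = normc x.
Proof. exact: normcN. Qed.

Lemma normc_sub x y : normc (x - y) <= normc x + normc y.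
Proof. by rewrite -[normc y]normc_opp normc_add. Qed.

Lemma normc_distC x y : normc (x - y) = normc (y - x).
Proof. by rewrite -normc_opp opprB. Qed.

Lemma normc_mul x y : normc (x * y) = normc x * normc y.
Proof. exact: normcM. Qed.

Lemma normc_inv x : normc x^-1 = (normc x)^-1.
Proof. exact: normcV. Qed.

Lemma normc_exp x n : normc (x ^+ n) = normc x ^+ n.
Proof.
elim: n => [|n IH]; first by rewrite !expr0; exact: normc1.
by rewrite !exprS normc_mul IH.
Qed.

Lemma normc_real r : normc r%:C = `|r|.
Proof. by rewrite /normc /= expr0n /= addr0 sqrtr_sqr. Qed.

Lemma normc_sum (I : Type) (s : seq I) (F : I -> R[i]) :
  normc (\sum_(i <- s) F i) <= \sum_(i <- s) normc (F i).
Proof.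
elim: s => [|i s IH]; first by rewrite !big_nil normc0.
by rewrite !big_cons (le_trans (normc_add _ _))// lerD2l.
Qed.

Lemma normc_prod m (F : nat -> R[i]) :
  normc (\prod_(i < m) F i) = \prod_(i < m) normc (F i).
Proof.
elim: m => [|m IH]; first by rewrite !big_ord0 normc1.
by rewrite !big_ord_recr /= normc_mul IH.
Qed.

Lemma normc_ge_sub x y : normc x - normc y <= normc (x - y).
Proof. by rewrite lerBlDr (le_trans _ (normc_add _ _))// subrK. Qed.

Lemma Re_le_normc z : `|complex.Re z| <= normc z.
Proof. by case: z => a b /=; rewrite -sqrtr_sqr ler_wsqrtr// lerDl sqr_ge0. Qed.

Lemma Im_le_normc z : `|complex.Im z| <= normc z.
Proof. by case: z => a b /=; rewrite -sqrtr_sqr ler_wsqrtr// lerDr sqr_ge0. Qed.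

Lemma normc_le_ReIm z : normc z <= `|complex.Re z| + `|complex.Im z|.
Proof.
case: z => a b /=; rewrite -[leRHS]ger0_norm ?addr_ge0// -sqrtr_sqr.
rewrite ler_wsqrtr// sqrrD !real_normK ?num_real// lerD2r lerDl.
by rewrite mulrn_wge0// mulr_ge0.
Qed.

End Modulus.

(** * Limits of complex sequences *)
Section ComplexLimits.
Context {R : realType}.
Implicit Types (x y : nat -> R[i]) (l m c : R[i]).

(** Convergence is measured by the real-valued modulus, so that all estimates
take place in R. *)
Definition ccvg x l := (fun n => normc (x n - l)) @ \oo --> (0 : R).

Lemma squeeze0 (e f : nat -> R) : (forall n, 0 <= e n <= f n) ->
  f @ \oo --> (0 : R) -> e @ \oo --> (0 : R).
Proof.
move=> ef f0; apply: (@squeeze_cvgr _ _ _ _ (fun=> 0) f) => //; last exact: cvg_cst.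
by apply: nearW => n; exact: ef.
Qed.

Lemma ccvg_le x l (e : nat -> R) : (forall n, normc (x n - l) <= e n) ->
  e @ \oo --> (0 : R) -> ccvg x l.
Proof. by move=> h; apply: squeeze0 => n; rewrite normc_ge0 h. Qed.

Lemma ccvg_cst l : ccvg (fun=> l) l.
Proof. by rewrite /ccvg subrr normc0; exact: cvg_cst. Qed.

Lemma ccvgD x y l m : ccvg x l -> ccvg y m -> ccvg (fun n => x n + y n) (l + m).
Proof.
move=> xl ym; apply: (@ccvg_le _ _ (fun n => normc (x n - l) + normc (y n - m))).
  by move=> n; rewrite opprD addrACA normc_add.
by rewrite -[X in _ --> X](addr0 (0 : R)); apply: cvgD.
Qed.

Lemma ccvgZ c x l : ccvg x l -> ccvg (fun n => c * x n) (c * l).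
Proof.
move=> xl; apply: (@ccvg_le _ _ (fun n => normc c * normc (x n - l))).
  by move=> n; rewrite -mulrBr normc_mul.
by rewrite -[X in _ --> X](mulr0 (normc c)); apply: cvgMl_tmp.
Qed.

Lemma ccvgB x y l m : ccvg x l -> ccvg y m -> ccvg (fun n => x n - y n) (l - m).
Proof.
move=> xl /(ccvgZ (-1)) ym.
have := ccvgD xl ym; rewrite mulN1r.
by under eq_fun do rewrite mulN1r.
Qed.

Lemma ccvgS x l : ccvg (fun n => x n.+1) l <-> ccvg x l.
Proof. by rewrite /ccvg (cvg_shiftS (fun n => normc (x n - l))). Qed.

Lemma ccvg_le_norm x l (C : R) : (forall n, normc (x n) <= C) -> ccvg x l ->
  normc l <= C.
Proof.
move=> xC xl.
have Cl : (fun n => C + normc (x n - l)) @ \oo --> C.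
  by rewrite -[X in _ --> X]addr0; apply: cvgD => //; exact: cvg_cst.
apply: (ler_cvg_to (cvg_cst (normc l)) Cl); apply: nearW => n.
rewrite -lerBlDr (le_trans _ (xC n))// lerBlDr normc_distC.
by rewrite (le_trans _ (normc_add _ _))// addrC subrK.
Qed.

Lemma ccvg_unique x l m : ccvg x l -> ccvg x m -> l = m.
Proof.
move=> xl xm; apply/eqP; rewrite -subr_eq0 -normc_eq0 eq_le normc_ge0 andbT.
apply: (@ccvg_le_norm _ _ 0 _ (ccvgB xl xm)) => n.
by rewrite subrr (@normc0 R) lexx.
Qed.

Lemma ccvg_Re (a b : nat -> R) (la lb : R) : a @ \oo --> la -> b @ \oo --> lb ->
  ccvg (fun n => (a n +i* b n)%C) (la +i* lb)%C.
Proof.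
move=> al bl; apply: (@ccvg_le _ _ (fun n => `|a n - la| + `|b n - lb|)).
  by move=> n; exact: normc_le_ReIm.
have := cvgD (cvg_norm (cvgB al (cvg_cst la))) (cvg_norm (cvgB bl (cvg_cst lb))).
by rewrite !subrr normr0 addr0; apply.
Qed.

Lemma bounded_variation_cvg (a : nat -> R) (C : R) :
  (forall n, \sum_(i < n) `|a i.+1 - a i| <= C) -> cvgn a.
Proof.
move=> aC.
suff h : cvgn (series (fun n => a n.+1 - a n)).
  have -> : a = (fun n => a 0%N + series (fun n => a n.+1 - a n) n).
    by apply/funext => n; rewrite /series /= telescope_sumr// addrC subrK.
  by apply: is_cvgD => //; exact: is_cvg_cst.
apply: normed_cvg; apply: nondecreasing_is_cvgn.
  apply/nondecreasing_seqP => n.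
  by rewrite /normed_series_of !seriesEnat /= big_nat_recr//= lerDl.
by exists C => _ [n _ <-]; rewrite /normed_series_of seriesEnat /= big_mkord.
Qed.

(** The real and imaginary parts have bounded variation as well, hence converge.
Absolutely convergent series and geometrically convergent iterations are both
of this kind. *)
Lemma bounded_variation_ccvg x (C : R) :
  (forall n, \sum_(i < n) normc (x i.+1 - x i) <= C) -> exists l, ccvg x l.
Proof.
move=> xC.
have re : cvgn (fun n => complex.Re (x n)).
  apply: (@bounded_variation_cvg _ C) => n; apply: le_trans (xC n).
  apply: ler_sum => i _; apply: le_trans (Re_le_normc _).
  by case: (x i.+1) (x i) => [? ?] [? ?].
have im : cvgn (fun n => complex.Im (x n)).
  apply: (@bounded_variation_cvg _ C) => n; apply: le_trans (xC n).
  apply: ler_sum => i _; apply: le_trans (Im_le_normc _).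
  by case: (x i.+1) (x i) => [? ?] [? ?].
exists (limn (fun n => complex.Re (x n)) +i* limn (fun n => complex.Im (x n)))%C.
have -> : x = (fun n => (complex.Re (x n) +i* complex.Im (x n))%C).
  by apply/funext => n; case: (x n).
by apply: ccvg_Re.
Qed.

Lemma ccvg_normc (x : nat -> R[i]) l : ccvg x l ->
  (fun n => normc (x n)) @ \oo --> normc l.
Proof.
move=> xl; apply/cvgrPdist_le => e e0; near=> n.
rewrite ler_norml lerBrDl lerBlDr.
have : normc (x n - l) <= e.
  have : `|0 - normc (x n - l)| <= e.
    by near: n; move/cvgrPdist_le : xl; exact.
  by rewrite sub0r normrN ger0_norm// normc_ge0.
have := normc_ge_sub (x n) l; have := normc_ge_sub l (x n).
rewrite (normc_distC l) => h1 h2 h3.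
by apply/andP; split; lra.
Unshelve. all: by end_near. Qed.

Lemma ccvg_norm_ge (x : nat -> R[i]) (l : R[i]) (c : R) N :
  (forall n, (N <= n)%N -> c <= normc (x n)) -> ccvg x l -> c <= normc l.
Proof.
move=> cx /ccvg_normc xl; apply: (ler_cvg_to (cvg_cst c) xl).
by exists N => // n; exact: cx.
Qed.

Lemma cvg_geometric0 (r C : R) : 0 <= r < 1 -> (fun n => C * r ^+ n) @ \oo --> (0 : R).
Proof.
move=> /andP[r0 r1]; rewrite -[X in _ --> X](mulr0 C); apply: cvgMl_tmp.
by apply: cvg_expr; rewrite ger0_norm.
Qed.

End ComplexLimits.

(** * The squared norm of l2 *)
Section SquareNorm.
Context {R : realType}.
Implicit Types (u v : l2 R) (f : int -> R[i]) (s : seq int).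

(** The square of [l2norm]; [sqnD] plays the part of the triangle inequality. *)
Definition sqn u : R := fine (\esum_(k in [set: int]) (normc (u k) ^+ 2)%:E).

Lemma sqnE u : (sqn u)%:E = \esum_(k in [set: int]) (normc (u k) ^+ 2)%:E.
Proof.
rewrite fineK// ge0_fin_numE ?esum_ge0// => [|k _]; last by rewrite lee_fin sqr_ge0.
by have := l2_square_summable u; rewrite unfold_in.
Qed.

Lemma finite_sum_le_sqn u s : uniq s -> \sum_(k <- s) normc (u k) ^+ 2 <= sqn u.
Proof.
move=> us; rewrite -lee_fin sqnE; apply: esum_ge; exists [set` s] => //.
  by split => //; exact: finite_seq.
by rewrite -fsbig_seq// sumEFin.
Qed.

Lemma esum_le_finite f (C : R) :
  (forall s, uniq s -> \sum_(k <- s) normc (f k) ^+ 2 <= C) ->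
  (\esum_(k in [set: int]) (normc (f k) ^+ 2)%:E <= C%:E)%E.
Proof.
move=> fC; apply: ge_ereal_sup => _ [F [finF _] <-].
by rewrite fsbig_finite//= sumEFin lee_fin fC// fset_uniq.
Qed.

Lemma square_summable_finite f (C : R) :
  (forall s, uniq s -> \sum_(k <- s) normc (f k) ^+ 2 <= C) ->
  f \in square_summable.
Proof.
by move=> /esum_le_finite fC; rewrite unfold_in (le_lt_trans fC)// ltry.
Qed.

(** Infinite sums are only ever met through their finite partial sums: this and
[finite_sum_le_sqn] characterize [sqn]. *)
Lemma sqn_le u (C : R) :
  (forall s, uniq s -> \sum_(k <- s) normc (u k) ^+ 2 <= C) -> sqn u <= C.
Proof. by move=> /esum_le_finite uC; rewrite -lee_fin sqnE. Qed.

Lemma sqn_ge0 u : 0 <= sqn u.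
Proof. by have := @finite_sum_le_sqn u [::] isT; rewrite big_nil. Qed.

Lemma normc_sqr_le_sqn u k : normc (u k) ^+ 2 <= sqn u.
Proof. by have := @finite_sum_le_sqn u [:: k] isT; rewrite big_seq1. Qed.

Lemma sqn_le0 u : sqn u <= 0 -> u = 0.
Proof.
move=> u0; apply/val_inj/funext => k /=; apply/eqP; rewrite -normc_eq0 -sqrf_eq0.
by rewrite eq_le sqr_ge0 andbT (le_trans (normc_sqr_le_sqn u k)).
Qed.

Lemma sqn0 : sqn (0 : l2 R) = 0.
Proof.
apply/eqP; rewrite eq_le sqn_ge0 andbT.
by apply: sqn_le => s _; rewrite big1// => k _; rewrite normc0 expr0n.
Qed.

(** Convexity of the square, applied to the decomposition
u + v = (1 - t) (u / (1 - t)) + t (v / t).  The free parameter t makes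
v = w S x cost only the factor |w| when t = |w|. *)
Lemma sqnD u v (t : R) : 0 < t < 1 ->
  sqn (u + v) <= (1 - t)^-1 * sqn u + t^-1 * sqn v.
Proof.
move=> /andP[t0 t1]; have t1' : 0 < 1 - t by rewrite subr_gt0.
apply: sqn_le => s us.
apply: (@le_trans _ _ ((1 - t)^-1 * (\sum_(k <- s) normc (u k) ^+ 2) +
    t^-1 * (\sum_(k <- s) normc (v k) ^+ 2))); last first.
  by rewrite lerD// ler_wpM2l ?finite_sum_le_sqn// invr_ge0 ltW.
rewrite !mulr_sumr -big_split/=; apply: ler_sum => k _.
set x := normc (u k); set y := normc (v k).
apply: (@le_trans _ _ ((x + y) ^+ 2)).
  by rewrite ler_sqr ?nnegrE ?addr_ge0 ?normc_ge0// normc_add.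
rewrite -subr_ge0.
have -> : (1 - t)^-1 * x ^+ 2 + t^-1 * y ^+ 2 - (x + y) ^+ 2 =
    (t * x - (1 - t) * y) ^+ 2 / (t * (1 - t)).
  by field; rewrite !gt_eqF.
by rewrite divr_ge0 ?sqr_ge0// mulr_ge0// ltW.
Qed.

Lemma sqnZ (a : R[i]) u : sqn (a *: u) <= normc a ^+ 2 * sqn u.
Proof.
apply: sqn_le => s us; under eq_bigr do rewrite normc_mul exprMn.
by rewrite -mulr_sumr ler_wpM2l ?sqr_ge0// finite_sum_le_sqn.
Qed.

Definition translate (j : int) u : l2 R :=
  L2 (square_summable_shift j (l2_square_summable u)).

Lemma sqn_translate j u : sqn (translate j u) <= sqn u.
Proof.
apply: sqn_le => s us.
rewrite -(big_map (fun k => k + j) predT (fun k => normc (u k) ^+ 2)).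
by rewrite finite_sum_le_sqn// map_inj_uniq// => k k' /addIr.
Qed.

Lemma delta_sum_le s : uniq s ->
  \sum_(k <- s) normc ((k == 0)%:R : R[i]) ^+ 2 <= 1.
Proof.
move=> us.
rewrite (eq_bigr (fun k => if k == 0 then 1 else 0)) => [|k _]; last first.
  by case: (k == 0); rewrite ?normc1 ?normc0 ?expr1n ?expr0n.
rewrite -big_mkcond big_const_seq iter_addr addr0 -[count _ s]/(count_mem 0 s).
by rewrite count_uniq_mem//; case: (0 \in s).
Qed.

Lemma delta_square_summable :
  (fun k : int => (k == 0)%:R : R[i]) \in @square_summable R.
Proof. exact: square_summable_finite delta_sum_le. Qed.

Definition delta0 : l2 R := L2 delta_square_summable.

Lemma sqn_delta0 : sqn delta0 <= 1.
Proof. by apply: sqn_le => s; exact: delta_sum_le. Qed.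

Lemma delta0_neq0 : delta0 != 0.
Proof.
apply/eqP => /(congr1 (fun u : l2 R => u 0)) /= /eqP.
by rewrite oner_eq0.
Qed.

End SquareNorm.


(** * The Joukowski parametrization *)

Section Joukowski.
Context {R : realType}.
Implicit Types w x y m : R[i].

Definition joukowski w := w + w^-1.

Lemma joukowski_inj x y :
  0 < normc x < 1 -> 0 < normc y < 1 -> joukowski x = joukowski y -> x = y.
Proof.
move=> /andP[x0 x1] /andP[y0 y1] /eqP; rewrite -subr_eq0.
have nx : x != 0 by rewrite -normc_gt0.
have ny : y != 0 by rewrite -normc_gt0.
have -> : joukowski x - joukowski y = (x - y) * (1 - (x * y)^-1).
  by rewrite /joukowski; field; rewrite nx ny.
rewrite mulf_eq0 => /orP[|]; rewrite subr_eq0 => /eqP //.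
move=> /(congr1 (@normc R)); rewrite normc1 normc_inv normc_mul => /eqP.
by rewrite eq_sym invr_eq1 => /eqP xy; exfalso; clear nx ny; nra.
Qed.

(** The two solutions of x + 1/x = m have product 1; the one in the closed unit
disc satisfies (x - w) (x - 1/w) = (m - w - 1/w) x, where |x - 1/w| is at least
1/|w| - 1. *)
Lemma joukowski_near w (e : R) : 0 < normc w < 1 -> 0 < e ->
  exists2 r : R, 0 < r & forall m, normc (m - joukowski w) < r ->
    exists w', normc (w' - w) < e /\ joukowski w' = m.
Proof.
move=> /andP[w0 w1] e0; have wn0 : w != 0 by rewrite -normc_gt0.
pose k := (normc w)^-1 - 1.
have k0 : 0 < k by rewrite subr_gt0 invf_gt1.
exists (e * k) => [|m mr]; first by rewrite mulr_gt0.
have [x [y [xy1 xym]]] : exists x y : R[i], x * y = 1 /\ x + y = m.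
  exists ((m + sqrtC (m ^+ 2 - 4)) / 2), ((m - sqrtC (m ^+ 2 - 4)) / 2).
  split; last by field.
  have -> : (m + sqrtC (m ^+ 2 - 4)) / 2 * ((m - sqrtC (m ^+ 2 - 4)) / 2) =
    (m ^+ 2 - sqrtC (m ^+ 2 - 4) ^+ 2) / 4 by field.
  by rewrite sqrtCK; field.
wlog x1 : x y xy1 xym / normc x <= 1.
  move=> H; have [x1|/ltW x1] := leP (normc x) 1; first exact: (H x y).
  apply: (H y x); rewrite 1?mulrC 1?addrC//.
  have := congr1 (@normc R) xy1; rewrite normc_mul normc1 => <-.
  by rewrite ler_peMl ?normc_ge0.
have x0 : x != 0 by apply/eqP => x0; move/eqP: xy1; rewrite x0 mul0r eq_sym oner_eq0.
have yE : y = x^-1 by apply: (mulfI x0); rewrite xy1 divff.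
have mE : joukowski x = m by rewrite -xym yE.
exists x; split => //.
have fac : (x - w) * (x - w^-1) = (m - joukowski w) * x.
  by rewrite -mE /joukowski; field; rewrite x0 wn0.
have kx : k <= normc (x - w^-1).
  rewrite normc_distC (le_trans _ (normc_ge_sub _ _))// normc_inv.
  by rewrite lerD2l lerN2.
rewrite -(ltr_pM2r k0); apply: le_lt_trans mr.
apply: (@le_trans _ _ (normc (x - w) * normc (x - w^-1))).
  by rewrite ler_wpM2l ?normc_ge0.
by rewrite -normc_mul fac normc_mul ler_piMr ?normc_ge0.
Qed.

Lemma joukowski_lipschitz w w' : w != 0 -> normc w / 2 <= normc w' ->
  normc (joukowski w' - joukowski w) <=
    (1 + 2 / normc w ^+ 2) * normc (w' - w).
Proof.
move=> w0 ww'; have nw0 : 0 < normc w by rewrite normc_gt0.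
have nw'0 : 0 < normc w' by apply: lt_le_trans ww'; rewrite divr_gt0.
have w'0 : w' != 0 by rewrite -normc_gt0.
have -> : joukowski w' - joukowski w = (1 - (w * w')^-1) * (w' - w).
  by rewrite /joukowski; field; rewrite w0 w'0.
rewrite normc_mul ler_wpM2r ?normc_ge0// (le_trans (normc_sub _ _))// normc1.
rewrite lerD2l normc_inv normc_mul -[leRHS]invrK lef_pV2 ?posrE ?mulr_gt0//.
  by rewrite invf_div expr2 -mulrA ler_wpM2l// ltW.
by rewrite invr_gt0 divr_gt0// exprn_gt0.
Qed.

End Joukowski.

(** * The resolvent of the free operator *)

Section FreeResolvent.
Context {R : realType}.
Implicit Types (u v : l2 R) (w : R[i]).

(** Fatou: a bound on all finite partial sums passes to a pointwise limit. *)
Lemma sqn_limit (V : nat -> l2 R) (f : int -> R[i]) (C : R) :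
  (forall k, ccvg (fun m => V m k) (f k)) -> (forall m, sqn (V m) <= C) ->
  f \in square_summable.
Proof.
move=> Vf VC; apply: (@square_summable_finite _ _ C) => s us.
have : (fun m => \sum_(k <- s) normc (V m k) ^+ 2) @ \oo -->
    \sum_(k <- s) normc (f k) ^+ 2.
  elim: s {us} => [|k s IH].
    by under eq_fun do rewrite big_nil; rewrite big_nil; exact: cvg_cst.
  under eq_fun do rewrite big_cons; rewrite big_cons; apply: cvgD => //.
  under eq_fun do rewrite expr2; rewrite expr2.
  by apply: cvgM; exact: ccvg_normc.
move=> h; apply: (ler_cvg_to h (cvg_cst C)); apply: nearW => m.
exact: le_trans (finite_sum_le_sqn _ us) (VC m).
Qed.

Lemma scaled_translate_le w j v : 0 < normc w ->
  (normc w)^-1 * sqn (w *: translate j v) <= normc w * sqn v.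
Proof.
move=> w0; rewrite ler_pdivrMl//; apply: le_trans (sqnZ _ _) _.
rewrite [leRHS]mulrA -expr2; apply: ler_wpM2l; first exact: sqr_ge0.
exact: sqn_translate.
Qed.

(** An a priori estimate: v = u + w S v gives
sqn v <= sqn u / (1 - |w|) + |w| sqn v, and the last term is absorbed on the
left.  It yields injectivity and boundedness of the inverse at once. *)
Lemma one_sub_translate_le w j v : 0 < normc w < 1 ->
  sqn v <= (1 - normc w)^-1 ^+ 2 * sqn (v - w *: translate j v).
Proof.
move=> w01; case/andP: (w01) => w0 w1.
set u := v - _; have -> : sqn v = sqn (u + w *: translate j v) by rewrite subrK.
have := sqnD u (w *: translate j v) w01; rewrite subrK.
have h := scaled_translate_le j v w0.
move=> /le_trans /(_ (lerD (lexx _) h)) {}h.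
have r1 : 0 < 1 - normc w by rewrite subr_gt0.
rewrite expr2 -mulrA mulrC ler_pdivlMr// mulrC mulrBl mul1r; lra.
Qed.

(** The partial sums of the Neumann series \sum_n w^n S^n u are the iterates of
v |-> u + w S v.  They are bounded in l2 and converge pointwise, which puts
the limit in l2 by [sqn_limit]. *)
Lemma one_sub_translate_surj w j u : 0 < normc w < 1 ->
  exists v, v - w *: translate j v = u.
Proof.
move=> w01; case/andP: (w01) => w0 w1.
have r1 : 0 < 1 - normc w by rewrite subr_gt0.
pose V m := iter m (fun v => u + w *: translate j v) (0 : l2 R).
have Vbound m : sqn (V m) <= (1 - normc w)^-1 ^+ 2 * sqn u.
  elim: m => [|m IH].
    by rewrite /= sqn0 mulr_ge0 ?sqr_ge0 ?sqn_ge0.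
  rewrite /= (le_trans (sqnD _ _ w01))//.
  have h := scaled_translate_le j (V m) w0.
  apply: le_trans (lerD (lexx _) (le_trans h (ler_wpM2l (ltW w0) IH))) _.
  rewrite le_eqVlt; apply/orP; left; apply/eqP; field.
  by rewrite gt_eqF.
have Vstep m k : normc (V m.+1 k - V m k) <= (1 + sqn u) * normc w ^+ m.
  elim: m k => [|m IH] k.
    rewrite mulr1 /= [X in normc X](_ : _ = u k); last first.
      by rewrite /= !fctE /= scaler0 addr0 subr0.
    have := normc_sqr_le_sqn u k.
    by have := sqr_ge0 (normc (u k) - 1); rewrite sqrrB1; have := normc_ge0 (u k); nra.
  rewrite [X in normc X](_ : _ = w * (V m.+1 (k + j) - V m (k + j))); last first.
    by rewrite /= !fctE /= /GRing.scale/=; ring.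
  by rewrite normc_mul exprS mulrCA ler_pM2l.
have cvgV k : exists l, ccvg (fun m => V m k) l.
  apply: (@bounded_variation_ccvg _ _ ((1 + sqn u) * (1 - normc w)^-1)) => n.
  apply: (@le_trans _ _ (\sum_(i < n) (1 + sqn u) * normc w ^+ i)).
    by apply: ler_sum => i _; exact: Vstep.
  rewrite -mulr_sumr ler_wpM2l ?addr_ge0 ?sqn_ge0//.
  rewrite -[leRHS]mul1r ler_pdivlMr// mulrC -opprB mulNr -subrX1 opprB.
  by rewrite lerBlDr lerDl exprn_ge0// ltW.
have [f Vf] := choice cvgV.
have fl2 := sqn_limit Vf Vbound.
exists (L2 fl2); apply/val_inj/funext => k /=.
rewrite !fctE /=.
apply/eqP; rewrite subr_eq; apply/eqP.
apply: (@ccvg_unique _ (fun m => V m.+1 k)); first exact/(ccvgS (fun m => V m k))/(Vf k).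
exact: (ccvgD (ccvg_cst (u k)) (ccvgZ w (Vf (k + j)))).
Qed.

(** On plane waves of quasi-momentum z this is the identity
z + 1/z - w - 1/w = - (1 - w z) (1 - w / z) / w. *)
Lemma free_schrodinger_factor w v : w != 0 ->
  free_schrodinger v - joukowski w *: v =
  - w^-1 *: ((v - w *: translate 1 v) - w *: translate (-1) (v - w *: translate 1 v)).
Proof.
move=> w0; apply/val_inj/funext => k /=; rewrite !fctE /= /GRing.scale/=.
by rewrite subrK /joukowski; field.
Qed.

Lemma free_resolvent_surj w u : 0 < normc w < 1 ->
  exists v, free_schrodinger v - joukowski w *: v = u.
Proof.
move=> w01; have w0 : w != 0 by rewrite -normc_gt0; case/andP: w01.
have [v1 v1E] := one_sub_translate_surj (-1) (- w *: u) w01.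
have [v vE] := one_sub_translate_surj 1 v1 w01.
exists v; rewrite free_schrodinger_factor// vE v1E scalerA mulrNN mulVf//.
by rewrite scale1r.
Qed.

Lemma free_resolvent_le w v : 0 < normc w < 1 ->
  sqn v <= (1 - normc w)^-1 ^+ 4 * sqn (free_schrodinger v - joukowski w *: v).
Proof.
move=> w01; have w0 : w != 0 by rewrite -normc_gt0; case/andP: w01.
have k0 : 0 <= (1 - normc w)^-1 ^+ 2 by rewrite sqr_ge0.
apply: le_trans (one_sub_translate_le 1 v w01) _.
apply: le_trans (ler_wpM2l k0 (one_sub_translate_le (-1) _ w01)) _.
rewrite mulrA -exprD; apply: ler_wpM2l; first by rewrite (exprD _ 2 2) mulr_ge0.
set x := (X in sqn X).
have -> : x = - w *: (free_schrodinger v - joukowski w *: v).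
  by rewrite free_schrodinger_factor// scalerA mulrNN divff// scale1r.
apply: le_trans (sqnZ _ _) _; rewrite normc_opp ler_piMl ?sqn_ge0//.
by case/andP : w01 => ? ?; rewrite expr_le1// ltW.
Qed.

Lemma free_resolvent_inj w v : 0 < normc w < 1 ->
  free_schrodinger v = joukowski w *: v -> v = 0.
Proof.
move=> w01 /eqP; rewrite -subr_eq0 => /eqP v0; apply: sqn_le0.
apply: le_trans (free_resolvent_le v w01) _; by rewrite v0 sqn0 mulr0.
Qed.

End FreeResolvent.

(** * Resolvent sets and the Green function *)
Section RankOne.
Context {R : realType}.
Implicit Types (T : {linear l2 R -> l2 R}) (u v g : l2 R) (w l : R[i]).

(** The inverse of a linear bijection is linear, and the a priori bound makes it
injective and bounded; so pointwise solvability suffices. *)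
Lemma resolvent_set_of_bound T l (c : R) : 
  (forall v, sqn v <= c * sqn (T v - l *: v)) ->
  (forall u, exists v, T v - l *: v = u) -> resolvent_set T l.
Proof.
move=> Tbound Tsurj; have [S TS] := choice Tsurj.
have Tinj u v : T u - l *: u = T v - l *: v -> u = v.
  move=> /eqP; rewrite -subr_eq0 => /eqP uv; apply/eqP; rewrite -subr_eq0; apply/eqP.
  apply: sqn_le0; apply: le_trans (Tbound _) _.
  by rewrite linearB scalerBr opprD addrACA -opprD uv sqn0 mulr0.
have Slin : linear S.
  move=> a u v; apply: Tinj; rewrite TS linearP scalerDr opprD addrACA TS.
  by rewrite scalerA mulrC -scalerA -scalerBr TS.
pose S' := HB.pack_for {linear l2 R -> l2 R} S
  (GRing.isLinear.Build R[i] (l2 R) (l2 R) *:%R S Slin).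
exists S'; split => //; last by move=> u; apply: Tinj; rewrite TS.
exists (Num.sqrt `|c|) => u.
rewrite /l2norm -/(sqn _) -/(sqn _) -sqrtrM// ler_wsqrtr//.
apply: le_trans (Tbound (S u)) _; rewrite TS.
by rewrite ler_wpM2r ?sqn_ge0 ?ler_norm.
Qed.

(** The recurrence has the solutions w^n and w^-n, and boundedness excludes the
second: h n = x n.+1 - w * x n satisfies h n = w^m h (n + m) for all m, hence
vanishes. *)
Lemma bounded_recurrence w (x : nat -> R[i]) (C : R) : 0 < normc w < 1 ->
  (forall n, normc (x n) <= C) ->
  (forall n, x n + x n.+2 = joukowski w * x n.+1) ->
  forall n, x n = w ^+ n * x 0%N.
Proof.
move=> w01 xC xrec; have w0 : w != 0 by rewrite -normc_gt0; case/andP: w01.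
pose h n := x n.+1 - w * x n.
have hS n : h n = w * h n.+1.
  rewrite /h; have -> : x n.+2 = joukowski w * x n.+1 - x n.
    by rewrite -xrec [x n + _]addrC addrK.
  by rewrite /joukowski; field.
have hm n m : h n = w ^+ m * h (n + m)%N.
  elim: m => [|m ->]; first by rewrite mul1r addn0.
  by rewrite addnS exprSr -mulrA -hS.
have h0 n : h n = 0.
  apply/eqP; rewrite -normc_eq0 eq_le normc_ge0 andbT.
  have w01' : 0 <= normc w < 1 by case/andP: w01 => /ltW -> ->.
  apply: (ler_cvg_to (cvg_cst (normc (h n))) (cvg_geometric0 (C + C) w01')).
  apply: nearW => m; rewrite (hm n m) normc_mul normc_exp mulrC.
  rewrite ler_wpM2r ?exprn_ge0 ?normc_ge0// (le_trans (normc_sub _ _))//.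
  rewrite lerD// normc_mul (le_trans _ (xC (n + m)%N))// ler_piMl ?normc_ge0//.
  by case/andP: w01 => _ /ltW.
elim=> [|n IH]; first by rewrite mul1r.
by move/eqP: (h0 n); rewrite /h subr_eq0 => /eqP ->; rewrite IH exprS mulrA.
Qed.

(** Both half-lines carry decaying solutions of the free recurrence; the
equation at the origin fixes their common value g(0) = 1 / (w - 1/w). *)
Lemma green_function w g n : 0 < normc w < 1 ->
  free_schrodinger g - joukowski w *: g = delta0 ->
  g n%:Z = w ^+ n / (w - w^-1).
Proof.
move=> w01 gE; have w0 : w != 0 by rewrite -normc_gt0; case/andP: w01.
have eqn k : g (k - 1) + g (k + 1) = joukowski w * g k + (k == 0)%:R.
  have := congr1 (fun u : l2 R => u k) gE.
  by rewrite /= !fctE /= /GRing.scale/= => <-; rewrite [RHS]addrC subrK.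
have gC k : normc (g k) <= 1 + sqn g.
  have := normc_sqr_le_sqn g k.
  by have := sqr_ge0 (normc (g k) - 1); rewrite sqrrB1; have := normc_ge0 (g k); nra.
have pos m : g m%:Z = w ^+ m * g 0.
  apply: (@bounded_recurrence w (fun m => g m%:Z) (1 + sqn g)) => // k.
  have e1 : k.+1%:Z - 1 = k%:Z by lia.
  have e2 : k.+1%:Z + 1 = k.+2%:Z by lia.
  by have := eqn k.+1%:Z; rewrite e1 e2 addr0.
have neg m : g (- m%:Z) = w ^+ m * g 0.
  have := @bounded_recurrence w (fun m => g (- m%:Z)) (1 + sqn g) w01.
  rewrite oppr0; apply => // k.
  have e1 : - k.+1%:Z + 1 = - k%:Z by lia.
  have e2 : - k.+1%:Z - 1 = - k.+2%:Z by lia.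
  by have := eqn (- k.+1%:Z); rewrite e1 e2 addr0 addrC.
have /= := eqn 0; rewrite sub0r add0r (pos 1%N) (neg 1%N) expr1 /joukowski => e0.
have g0 : g 0 * (w - w^-1) = 1.
  have -> : g 0 * (w - w^-1) = w * g 0 + w * g 0 - (w + w^-1) * g 0 by ring.
  by rewrite e0 addrC addKr.
have n0 : w - w^-1 != 0.
  by apply/eqP => e; move/eqP: g0; rewrite e mulr0 eq_sym oner_eq0.
by rewrite pos; apply: (mulIf n0); rewrite -mulrA g0 mulr1 mulfVK.
Qed.

End RankOne.

(** * Rank-one perturbations *)
Section Perturbation.
Context {R : realType}.
Variables (ell : {scalar l2 R}) (beta : R).
Hypothesis ell_bounded : forall u, normc (ell u) ^+ 2 <= beta * sqn u.
Implicit Types (u v g : l2 R) (w l : R[i]).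

Definition rank_one_map u : l2 R := ell u *: delta0.

Lemma rank_one_map_linear : linear rank_one_map.
Proof. by move=> a u v; rewrite /rank_one_map linearP scalerDl scalerA. Qed.

HB.instance Definition _ := GRing.isLinear.Build R[i] (l2 R) (l2 R) _
  rank_one_map rank_one_map_linear.

Let B : {linear l2 R -> l2 R} := (free_schrodinger \+ rank_one_map)%R.

Lemma perturbedE u : B u = free_schrodinger u + ell u *: delta0.
Proof. by []. Qed.

Lemma perturbedB l u : B u - l *: u =
  (free_schrodinger u - l *: u) + ell u *: delta0.
Proof. by rewrite perturbedE addrAC. Qed.

Lemma free_subP l a u v :
  free_schrodinger (a *: u + v) - l *: (a *: u + v) =
  a *: (free_schrodinger u - l *: u) + (free_schrodinger v - l *: v).
Proof.
by rewrite linearP scalerDr opprD addrACA scalerBr !scalerA [l * a]mulrC.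
Qed.

Lemma free_subZ l a u :
  free_schrodinger (a *: u) - l *: (a *: u) = a *: (free_schrodinger u - l *: u).
Proof. by rewrite linearZ_LR scalerBr !scalerA mulrC. Qed.

Lemma bounded_rank_one_map : bounded_op rank_one_map.
Proof.
exists (Num.sqrt `|beta|) => u.
rewrite /l2norm -/(sqn _) -/(sqn _) -sqrtrM// ler_wsqrtr//.
apply: le_trans (sqnZ _ _) _.
apply: (@le_trans _ _ (normc (ell u) ^+ 2)).
  by rewrite ler_piMr ?sqr_ge0// sqn_delta0.
by apply: le_trans (ell_bounded u) _; rewrite ler_wpM2r ?sqn_ge0 ?ler_norm.
Qed.

Lemma rank_one_rank_one_map u : ell u != 0 -> rank_one rank_one_map.
Proof.
move=> lu; exists (fun=> delta0); split.
  move=> c; rewrite big_ord1 => /eqP; rewrite scaler_eq0 (negPf delta0_neq0) orbF.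
  by move=> /eqP c0 i; rewrite (ord1 i).
apply/seteqP; split => [_ [v _ <-]|_ [c _ <-]].
  by exists (fun=> ell v) => //; rewrite big_ord1.
exists ((c ord0 / ell u) *: u) => //.
by rewrite /rank_one_map linearZ big_ord1 /= mulfVK.
Qed.

(** Solving (A - l) v + ell(v) delta0 = u amounts to v = v0 - ell(v) g with
(A - l) v0 = u, and applying ell determines ell(v) because 1 + ell(g) is
nonzero. *)
Lemma perturbed_resolvent w g : 0 < normc w < 1 ->
  free_schrodinger g - joukowski w *: g = delta0 -> 1 + ell g != 0 ->
  resolvent_set B (joukowski w).
Proof.
move=> w01 gE D0.
pose K := (1 - normc w)^-1 ^+ 4.
have K0 : 0 <= K by rewrite /K (exprD _ 2 2) mulr_ge0 ?sqr_ge0.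
have half : 0 < (2^-1 : R) < 1 by apply/andP; split; lra.
pose q := normc (1 + ell g)^-1 ^+ 2.
apply: (@resolvent_set_of_bound _ _ _
  (2 * K + 2 * (q * `|beta| * K * sqn g))) => [v|u].
  have [v0 v0E] := free_resolvent_surj (B v - joukowski w *: v) w01.
  have vE : v = v0 - ell v *: g.
    apply/eqP; rewrite -subr_eq0; apply/eqP.
    apply: (free_resolvent_inj w01); apply/eqP; rewrite -subr_eq0; apply/eqP.
    have -> : v - (v0 - ell v *: g) = ell v *: g + (-1 *: v0 + v).
      by rewrite opprB scaleN1r addrC addrA.
    rewrite !free_subP gE v0E scaleN1r perturbedB.
    by rewrite addrCA [X in _ + X]addrC addNr.
  have ev : ell v = ell v0 / (1 + ell g).
    apply: (mulIf D0); rewrite mulfVK// mulrDr mulr1 {1}vE linearB linearZ /=.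
    by rewrite subrK.
  have -> : sqn v = sqn (v0 + - ell v *: g) by rewrite {1}vE scaleNr.
  apply: le_trans (sqnD _ _ half) _.
  have h1 : sqn v0 <= K * sqn (B v - joukowski w *: v).
    by rewrite -v0E; exact: free_resolvent_le.
  have h2 : normc (ell v) ^+ 2 <= q * (`|beta| * (K * sqn (B v - joukowski w *: v))).
    rewrite ev normc_mul exprMn mulrC ler_wpM2l ?sqr_ge0//.
    apply: le_trans (ell_bounded v0) _.
    apply: le_trans (ler_wpM2r (sqn_ge0 _) (ler_norm beta)) _.
    by rewrite ler_wpM2l.
  have := sqnZ (- ell v) g; rewrite normc_opp.
  have := ler_wpM2r (sqn_ge0 g) h2.
  have -> : (1 - 2^-1 : R)^-1 = 2 by field. 
  rewrite invrK; lra.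
have [v0 v0E] := free_resolvent_surj u w01.
exists (v0 - (ell v0 / (1 + ell g)) *: g).
set c := _ / _.
rewrite perturbedB -scaleNr [v0 + _]addrC free_subP gE v0E linearP /=.
rewrite addrAC -scalerDl mulNr.
have -> : - c + (- (c * ell g) + ell v0) = 0.
  by rewrite addrA -opprD -{1}[c]mulr1 -mulrDr /c divfK// addNr.
by rewrite scale0r add0r.
Qed.

(** Since g2 is the derivative of g with respect to l, the number ell(g2) is the
derivative of 1 + ell(g).  Applying the resolvent identity twice gives
g' = g + d g2 + d^2 x with d = l' - l and x bounded uniformly in l', so that
1 + ell(g') is of second order when both 1 + ell(g) and ell(g2) vanish. *)
Lemma green_perturbation w g g2 : 0 < normc w < 1 ->
  free_schrodinger g - joukowski w *: g = delta0 ->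
  free_schrodinger g2 - joukowski w *: g2 = g ->
  1 + ell g = 0 -> ell g2 = 0 -> forall rho : R, rho < 1 ->
  exists2 K : R, 0 <= K & forall w' g', 0 < normc w' -> normc w' <= rho ->
    free_schrodinger g' - joukowski w' *: g' = delta0 ->
    normc (1 + ell g') <= K * normc (joukowski w' - joukowski w) ^+ 2.
Proof.
move=> w01 gE g2E D0 l0 rho rho1.
pose C := (1 - normc w)^-1 ^+ 4; pose C' := (1 - rho)^-1 ^+ 4.
have C0 : 0 <= C by rewrite /C (exprD _ 2 2) mulr_ge0 ?sqr_ge0.
exists (Num.sqrt (`|beta| * (C * (C * C')))); first exact: sqrtr_ge0.
move=> w' g' w'0 w'rho g'E.
have w'01 : 0 < normc w' < 1 by rewrite w'0 (le_lt_trans w'rho).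
set d := joukowski w' - joukowski w.
have Pg' : free_schrodinger g' - joukowski w *: g' = d *: g' + delta0.
  by rewrite -g'E scalerBl [RHS]addrC [RHS]addrA subrK.
have [y yE] := free_resolvent_surj g' w01.
have [x xE] := free_resolvent_surj y w01.
have inj u v : free_schrodinger u - joukowski w *: u =
    free_schrodinger v - joukowski w *: v -> u = v.
  move=> uv; apply/eqP; rewrite -subr_eq0; apply/eqP.
  apply: (free_resolvent_inj w01); apply/eqP; rewrite -subr_eq0; apply/eqP.
  by rewrite [u - v]addrC -scaleN1r free_subP scaleN1r uv addNr.
have g'y : g' = d *: y + g by apply: inj; rewrite Pg' free_subP yE gE.
have yx : y = d *: x + g2 by apply: inj; rewrite yE g'y free_subP xE g2E.
have -> : 1 + ell g' = d ^+ 2 * ell x.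
  rewrite g'y linearP yx linearP /= l0 addr0 addrCA D0 addr0.
  by rewrite expr2 mulrA.
rewrite normc_mul normc_exp mulrC ler_wpM2r ?sqr_ge0//.
rewrite -[leLHS]ger0_norm ?normc_ge0// -sqrtr_sqr ler_wsqrtr//.
apply: le_trans (ell_bounded x) _.
apply: le_trans (ler_wpM2r (sqn_ge0 _) (ler_norm beta)) _.
rewrite ler_wpM2l//; apply: le_trans (free_resolvent_le x w01) _.
rewrite xE ler_wpM2l//; apply: le_trans (free_resolvent_le y w01) _.
rewrite yE ler_wpM2l//; apply: le_trans (free_resolvent_le g' w'01) _.
rewrite g'E -[leRHS]mulr1 ler_pM ?sqn_ge0 ?sqn_delta0//.
  by rewrite (exprD _ 2 2) mulr_ge0 ?sqr_ge0.
rewrite /C' !exprVn lef_pV2 ?posrE ?exprn_gt0 ?subr_gt0//; last first.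
  by case/andP: w'01.
case/andP: w'01 => _ w'1.
apply: lerXn2r; rewrite ?nnegrE; lra.
Qed.

(** If (B - l) u = c g then u = c g2 - ell(u) g.  Applying ell, and using
ell(g) = -1, gives c ell(g2) = 0; hence no Jordan chain starts at g. *)
Lemma root_space_span w g g2 : 0 < normc w < 1 ->
  free_schrodinger g - joukowski w *: g = delta0 ->
  free_schrodinger g2 - joukowski w *: g2 = g ->
  1 + ell g = 0 -> ell g2 != 0 ->
  root_space B (joukowski w) = [set c *: g | c in [set: R[i]]].
Proof.
move=> w01 gE g2E D0 l0.
have Bg : B g - joukowski w *: g = 0.
  by rewrite perturbedB gE -[X in X + _]scale1r -scalerDl D0 scale0r.
apply/seteqP; split=> [u [n]|_ [c _ <-]]; last first.
  exists 1%N; transitivity (B (c *: g) - joukowski w *: (c *: g)) => //.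
  by rewrite linearZ_LR scalerA mulrC -scalerA -scalerBr Bg scaler0.
elim: n u => [u /= ->|n IH u]; first by exists 0 => //; rewrite scale0r.
rewrite iterSr => /IH [c _ cE].
have uE : u = c *: g2 + (- ell u) *: g.
  apply/eqP; rewrite -subr_eq0; apply/eqP.
  apply: (free_resolvent_inj w01); apply/eqP; rewrite -subr_eq0; apply/eqP.
  rewrite [u - _]addrC -scaleN1r !free_subP free_subZ g2E gE.
  rewrite cE perturbedB scaleN1r scaleNr.
  by rewrite addrK addNr.
have c0 : c = 0.
  have := congr1 ell uE; rewrite linearP linearZ /= => /eqP.
  have -> : ell g = -1 by apply/eqP; rewrite -addr_eq0 addrC D0.
  rewrite mulrN1 opprK -subr_eq0 opprD addrA addrAC subrr sub0r oppr_eq0.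
  by rewrite mulf_eq0 (negPf l0) orbF => /eqP.
by exists (- ell u) => //; rewrite {2}uE c0 scale0r add0r.
Qed.

(** The lower bound c |w' - w| on the modulus of 1 + ell(g') expresses that the
zero has order one without mentioning derivatives.  It excludes ell(g2) = 0 by
comparison with [green_perturbation], and it keeps a punctured neighbourhood of
l in the resolvent set. *)
Lemma simple_zero_eigenvalue w g (c r : R) : 0 < normc w < 1 ->
  free_schrodinger g - joukowski w *: g = delta0 -> 1 + ell g = 0 ->
  0 < c -> 0 < r ->
  (forall w' g', normc (w' - w) < r -> 0 < normc w' < 1 ->
    free_schrodinger g' - joukowski w' *: g' = delta0 ->
    c * normc (w' - w) <= normc (1 + ell g')) ->
  discrete_spectrum B (joukowski w) /\ (1 <= alg_mult B (joukowski w))%N.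
Proof.
move=> w01 gE D0 c0 r0 Dlow; case/andP: (w01) => w0 w1.
have wn0 : w != 0 by rewrite -normc_gt0.
have g0 : g != 0.
  apply/eqP => g0; move/eqP: gE; rewrite g0 linear0 scaler0 subr0 eq_sym.
  by rewrite (negPf delta0_neq0).
have [g2 g2E] := free_resolvent_surj g w01.
have l0 : ell g2 != 0.
  apply/eqP => l0; pose rho := (1 + normc w) / 2.
  have rho1 : rho < 1 by rewrite /rho; lra.
  have [K K0 Kb] := green_perturbation w01 gE g2E D0 l0 rho1.
  pose L := 1 + 2 / normc w ^+ 2.
  have L0 : 0 < L by rewrite addr_gt0// divr_gt0// exprn_gt0.
  have KL0 : 0 < K * L ^+ 2 + 1 by rewrite ltr_wpDl// mulr_ge0// sqr_ge0.
  (* The step t keeps w + t inside the disc, away from 0 and within r of w, and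
     is so small that a quantity of size K (L t)^2 cannot exceed c t. *)
  pose t := Num.min (r / 2) (Num.min ((1 - normc w) / 2)
    (Num.min (normc w / 2) (c / 2 / (K * L ^+ 2 + 1)))).
  have t0 : 0 < t by rewrite !lt_min !divr_gt0// subr_gt0.
  have : t <= t by []. 
  rewrite {2}/t !le_min => /and4P[tr t1 t2 tc].
  pose w' := w + t%:C.
  have w'w : normc (w' - w) = t by rewrite /w' addrC addKr normc_real gtr0_norm.
  have nw' : normc w' <= rho.
    rewrite (le_trans (normc_add _ _))// normc_real gtr0_norm// /rho; lra.
  have nw'2 : normc w / 2 <= normc w'.
    have := normc_ge_sub w w'; rewrite normc_distC w'w; lra.
  have w'0 : 0 < normc w' by apply: lt_le_trans nw'2; rewrite divr_gt0.
  have w'01 : 0 < normc w' < 1 by rewrite w'0 (le_lt_trans nw').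
  have [g' g'E] := free_resolvent_surj delta0 w'01.
  have tr' : normc (w' - w) < r by rewrite w'w; lra.
  have := le_trans (Dlow _ _ tr' w'01 g'E) (Kb _ _ w'0 nw' g'E).
  have jl := joukowski_lipschitz wn0 nw'2; rewrite -/L w'w in jl.
  have jl2 : normc (joukowski w' - joukowski w) ^+ 2 <= (L * t) ^+ 2.
    by rewrite ler_sqr// ?nnegrE ?normc_ge0// mulr_ge0// ltW.
  move=> /le_trans /(_ (ler_wpM2l K0 jl2)).
  rewrite w'w exprMn [t ^+ 2]expr2 !mulrA ler_pM2r//.
  move: tc; rewrite ler_pdivlMr// mulrDr mulr1 => tc h; nra.
have rsE := root_space_span w01 gE g2E D0 l0.
have rs1 : has_dim (root_space B (joukowski w)) 1.
  exists (fun=> g); split.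
    move=> a; rewrite big_ord1 => /eqP; rewrite scaler_eq0 (negPf g0) orbF.
    by move=> /eqP a0 i; rewrite (ord1 i).
  rewrite rsE; apply/seteqP; split => [_ [a _ <-]|_ [a _ <-]].
    by exists (fun=> a) => //; rewrite big_ord1.
  by exists (a ord0) => //; rewrite big_ord1.
split; last first.
  rewrite /alg_mult; case: xgetP => [n _ [e [_ eE]]|/(_ 1%N)//].
  rewrite lt0n; apply/eqP => n0; subst n.
  have : root_space B (joukowski w) g by rewrite rsE; exists 1 => //; rewrite scale1r.
  by rewrite eE => -[a _]; rewrite big_ord0 => /eqP; rewrite eq_sym (negPf g0).
split; last 1 first.
- pose e := Num.min r (Num.min (normc w) (1 - normc w)).
  have e0 : 0 < e by rewrite !lt_min r0 w0 subr_gt0.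
  have [d d0 dP] := joukowski_near w01 e0.
  exists d => // m mspec /dP [w' [w'e w'm]].
  move: w'e; rewrite !lt_min => /and3P[w'r w'1 w'2].
  apply/eqP/negPn/negP => mn; apply: mspec; rewrite -w'm.
  have w'01 : 0 < normc w' < 1.
    have := normc_ge_sub w w'; rewrite normc_distC.
    have := normc_ge_sub w' w => h1 h2; apply/andP; split; lra.
  have [g' g'E] := free_resolvent_surj delta0 w'01.
  apply: (perturbed_resolvent w'01 g'E).
  rewrite -normc_gt0; apply: lt_le_trans (Dlow _ _ w'r w'01 g'E).
  rewrite mulr_gt0// normc_gt0 subr_eq0; apply/eqP => ww'.
  by move/eqP: mn; rewrite -w'm ww'.
- exists g; split => //; apply/eqP; rewrite -subr_eq0 perturbedB gE.
  by rewrite -[X in X + _]scale1r -scalerDl D0 scale0r.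
- by exists 1%N.
Qed.

End Perturbation.

(** * Functionals given by a square-summable sequence *)
Section Pairing.
Context {R : realType}.
Implicit Types (u v : l2 R) (b : nat -> R).

Lemma half_line_sum_le_sqn u n : \sum_(i < n) normc (u i%:Z) ^+ 2 <= sqn u.
Proof.
rewrite -(big_mkord xpredT (fun i => normc (u i%:Z) ^+ 2)).
rewrite -(big_map Posz predT (fun k => normc (u k) ^+ 2)).
by apply: finite_sum_le_sqn; rewrite map_inj_uniq ?iota_uniq// => ? ? [].
Qed.

(** The weighted inequality 2 |b_k u_k| <= t b_k^2 + |u_k|^2 / t gives absolute
convergence for t = 1, and the Cauchy-Schwarz bound for the optimal t. *)
Lemma pairing_exists b (beta : R) : 0 < beta ->
  (forall n, \sum_(i < n) b i ^+ 2 <= beta) ->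
  exists ell : {scalar l2 R},
    (forall u, ccvg (fun n => \sum_(i < n) (b i)%:C * u i%:Z) (ell u)) /\
    (forall u, normc (ell u) ^+ 2 <= beta * sqn u).
Proof.
move=> beta0 bbeta.
pose x u n := \sum_(i < n) (b i)%:C * u i%:Z.
have xle u t n : 0 < t ->
    \sum_(i < n) normc ((b i)%:C * u i%:Z) <= (t * beta + t^-1 * sqn u) / 2.
  move=> t0; apply: (@le_trans _ _
    ((t * \sum_(i < n) b i ^+ 2 + t^-1 * \sum_(i < n) normc (u i%:Z) ^+ 2) / 2)).
    rewrite !mulr_sumr -big_split /= mulr_suml; apply: ler_sum => i _.
    rewrite normc_mul normc_real -(real_normK (num_real (b i))).
    set p := `|b i|; set q := normc _.
    rewrite -subr_ge0.
    have -> : (t * p ^+ 2 + t^-1 * q ^+ 2) / 2 - p * q = (t * p - q) ^+ 2 / (2 * t).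
      by field; rewrite gt_eqF.
    by rewrite divr_ge0 ?sqr_ge0// mulr_ge0// ltW.
  rewrite ler_pM2r//; apply: lerD; first by rewrite ler_pM2l.
  by apply: ler_wpM2l; [rewrite invr_ge0 ltW|exact: half_line_sum_le_sqn].
have xcvg u : exists l, ccvg (x u) l.
  apply: (@bounded_variation_ccvg _ _ ((1 * beta + 1^-1 * sqn u) / 2)) => n.
  apply: le_trans (xle u 1 n ltr01); apply: ler_sum => i _.
  by rewrite /x big_ord_recr /= addrAC subrr add0r.
have [l xl] := choice xcvg.
have lin : scalar l.
  move=> a u v; apply: (ccvg_unique (xl _)).
  have -> : x (a *: u + v) = (fun n => a * x u n + x v n).
    apply/funext => n; rewrite /x mulr_sumr -big_split; apply: eq_bigr => i _.
    by rewrite /= !fctE /= /GRing.scale /=; ring.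
  by apply: ccvgD (xl v); exact: ccvgZ.
pose ell := HB.pack_for {scalar l2 R} l
  (GRing.isLinear.Build R[i] (l2 R) R[i] *%R l lin).
exists ell; split => // u; change (normc (l u) ^+ 2 <= beta * sqn u).
have [->|lu0] := eqVneq (l u) 0.
  by rewrite normc0 expr0n mulr_ge0 ?sqn_ge0// ltW.
have s0 : 0 < normc (l u) by rewrite normc_gt0.
set s := normc (l u) in s0 *.
(* This is the value of t that turns the bound xle into s^2 <= beta sqn u. *)
have t0 : 0 < s / beta by rewrite divr_gt0.
have : s <= (s / beta * beta + (s / beta)^-1 * sqn u) / 2.
  apply: ccvg_le_norm (xl u) => n; apply: le_trans (normc_sum _ _) _.
  exact: xle.
rewrite mulfVK ?gt_eqF// invf_div => h.
have : s <= beta / s * sqn u by lra.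
by rewrite mulrAC ler_pdivlMr// expr2.
Qed.

End Pairing.

(** * One Blaschke factor acting on coefficients *)

Section Blaschke.
Context {R : realType}.
Implicit Types (a : R) (f : nat -> R) (w : R[i]).

(** The coefficients of z f(z) / (1 - a z). *)
Fixpoint delay a f n : R :=
  if n is m.+1 then a * delay a f m + f m else 0.

(** The coefficients of f(z) (a - z) / (1 - a z), written as
a f(z) - (1 - a^2) z f(z) / (1 - a z). *)
Definition blaschke_step a f n : R := a * f n - (1 - a ^+ 2) * delay a f n.

(** The map (delay n, f n) |-> (delay n.+1, blaschke_step n) is orthogonal once
the first coordinate is weighted by 1 - a^2.  This is the finite form of the
fact that a Blaschke factor has modulus 1 on the unit circle. *)
Lemma blaschke_energy a f n :
  \sum_(i < n) blaschke_step a f i ^+ 2 + (1 - a ^+ 2) * delay a f n ^+ 2 =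
  \sum_(i < n) f i ^+ 2.
Proof.
elim: n => [|n IH]; first by rewrite !big_ord0 /= expr0n mulr0 addr0.
by rewrite !big_ord_recr /= -IH /blaschke_step; ring.
Qed.

Lemma blaschke_step_sum_le a f n : 0 < a < 1 ->
  \sum_(i < n) blaschke_step a f i ^+ 2 <= \sum_(i < n) f i ^+ 2.
Proof.
move=> /andP[a0 a1]; rewrite -(blaschke_energy a f n) lerDl mulr_ge0 ?sqr_ge0//.
by rewrite subr_ge0 expr_le1// ltW.
Qed.

Lemma delay_le a f n : 0 < a < 1 -> (forall i, `|f i| <= 1) ->
  `|delay a f n| <= n%:R /\ `|delay a f n| <= (1 - a)^-1.
Proof.
move=> /andP[a0 a1] f1; have a1' : 0 < 1 - a by rewrite subr_gt0.
elim: n => [|n [IH1 IH2]] /=; first by rewrite normr0; split=> //; rewrite invr_ge0 ltW.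
have h : `|a * delay a f n + f n| <= a * `|delay a f n| + 1.
  rewrite (le_trans (ler_normD _ _))// lerD// normrM ger0_norm// ltW//.
split.
  rewrite (le_trans h)// -natr1 lerD2r (le_trans _ IH1)// ler_piMl// ltW//.
rewrite (le_trans h)//; apply: (@le_trans _ _ (a * (1 - a)^-1 + 1)).
  by rewrite lerD2r ler_pM2l.
by rewrite le_eqVlt; apply/orP; left; apply/eqP; field; rewrite gt_eqF.
Qed.

Definition psum f w n := \sum_(i < n) (f i)%:C * w ^+ i.

Lemma normr_le1_of_sum f n :
  (forall m, \sum_(i < m) f i ^+ 2 <= 1) -> `|f n| <= 1.
Proof.
move=> f1; rewrite -(@expr_le1 _ 2)// real_normK ?num_real//.
apply: le_trans (f1 n.+1); rewrite big_ord_recr /= lerDr.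
by apply: sumr_ge0 => i _; exact: sqr_ge0.
Qed.

(** The recursion of [delay] reads (1 - a w) Y_n = w F_n - y_n w^n for the
partial sums Y_n and F_n, and the last term vanishes in the limit because [delay] is
bounded. *)
Lemma psum_blaschke_step a f w F : 0 < a < 1 -> (forall i, `|f i| <= 1) ->
  normc w < 1 -> ccvg (psum f w) F ->
  ccvg (psum (blaschke_step a f) w) ((a%:C - w) / (1 - a%:C * w) * F).
Proof.
move=> a01 f1 w1 fF; case/andP: (a01) => a0 a1.
have D0 : 1 - a%:C * w != 0.
  rewrite subr_eq0; apply/eqP => /(congr1 (@normc R)).
  rewrite normc1 normc_mul normc_real gtr0_norm// => e.
  have := normc_ge0 w; nra.
have yE n : psum (delay a f) w n =
    (w * psum f w n - (delay a f n)%:C * w ^+ n) / (1 - a%:C * w).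
  apply: (mulIf D0); rewrite mulfVK//.
  elim: n => [|n IH]; first by rewrite /psum !big_ord0 /= !mul0r mulr0 subr0.
  rewrite /psum !big_ord_recr /= -!/(psum _ _ _) mulrDl IH.
  by rewrite rmorphD rmorphM /= exprS; ring.
have y0 : ccvg (fun n => (delay a f n)%:C * w ^+ n) 0.
  apply: (@ccvg_le _ _ _ (fun n => (1 - a)^-1 * normc w ^+ n)).
    move=> n; rewrite subr0 normc_mul normc_real normc_exp.
    by rewrite ler_wpM2r ?exprn_ge0 ?normc_ge0//; case: (delay_le n a01 f1).
  by apply: cvg_geometric0; rewrite normc_ge0.
have -> : psum (blaschke_step a f) w = (fun n => a%:C * psum f w n +
    - (1 - a%:C ^+ 2) / (1 - a%:C * w) *
      (w * psum f w n - (delay a f n)%:C * w ^+ n)).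
  apply/funext => n; rewrite -mulrA [_^-1 * _]mulrC -yE /psum !mulr_sumr -big_split.
  apply: eq_bigr => i _.
  by rewrite /blaschke_step /= rmorphB !rmorphM /= rmorphB /= rmorphXn /= ; ring.
have -> : (a%:C - w) / (1 - a%:C * w) * F = a%:C * F +
    - (1 - a%:C ^+ 2) / (1 - a%:C * w) * (w * F - 0) by field.
by apply: ccvgD; apply: ccvgZ => //; apply: ccvgB => //; exact: ccvgZ.
Qed.

End Blaschke.

(** * Infinite Blaschke products *)
Section BlaschkeProduct.
Context {R : realType}.
Variable d : nat -> R.
Hypothesis d01 : forall i, 0 < d i < 1.
Hypothesis d_inj : injective d.
Hypothesis d_sum : cvgn (series d).
Implicit Types (w : R[i]).

Let a i : R := 1 - d i.

Let a01 i : 0 < a i < 1.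
Proof. by have := d01 i; rewrite /a => /andP[? ?]; apply/andP; split; lra. Qed.

Fixpoint blaschke_coef m : nat -> R :=
  if m is m'.+1 then blaschke_step (a m') (blaschke_coef m')
  else fun n => (n == 0%N)%:R.

Lemma blaschke_coef_sum m n : \sum_(i < n) blaschke_coef m i ^+ 2 <= 1.
Proof.
elim: m n => [|m IH] n; last first.
  by apply: le_trans (IH n); exact: blaschke_step_sum_le.
case: n => [|n]; first by rewrite big_ord0.
by rewrite big_ord_recl big1 ?addr0 /= ?expr1n// => i _; rewrite expr0n.
Qed.

Lemma blaschke_coef_le1 m n : `|blaschke_coef m n| <= 1.
Proof.
by apply: normr_le1_of_sum => k; exact: blaschke_coef_sum.
Qed.

(** In terms of f and y = [delay], the change is - d (f + (2 - d) y), and the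
n-th term of y is a sum of n numbers of absolute value at most 1. *)
Lemma blaschke_coef_step m n :
  `|blaschke_coef m.+1 n - blaschke_coef m n| <= d m * (1 + 2 * n%:R).
Proof.
have /andP[a0 a1] := a01 m; have /andP[d0 d1] := d01 m.
have [y1 _] := delay_le n (a01 m) (blaschke_coef_le1 m).
rewrite /= /blaschke_step.
set f := blaschke_coef m n; set y := delay _ _ _ in y1 *.
have -> : a m * f - (1 - a m ^+ 2) * y - f = - (d m * (f + (2 - d m) * y)).
  by rewrite /a; ring.
rewrite normrN normrM (ger0_norm (ltW d0)) ler_pM2l//.
rewrite (le_trans (ler_normD _ _))// lerD ?blaschke_coef_le1// normrM.
by rewrite ler_pM// ger0_norm; lra.
Qed.

Lemma tail_sum (e : R) : 0 < e ->
  exists N, forall m, \sum_(N <= i < m) d i <= e.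
Proof.
move=> e0; have /cvgrPdist_le /(_ _ e0) [N _ HN] := d_sum.
exists N => m; have [Nm|/ltnW mN] := leqP N m; last by rewrite big_geq// ltW.
have := HN N (leqnn N) => /=.
have : series d m <= limn (series d).
  apply: nondecreasing_cvgn_le => //; apply/nondecreasing_seqP => n.
  by rewrite !seriesEnat /= big_nat_recr//= lerDl ltW//; case/andP: (d01 n).
rewrite !seriesEnat /= (big_cat_nat (leq0n N) Nm) /= ler_norml => h1 /andP[_ h2].
move: h1 h2; set S := \sum_(0 <= i < N) _; set T := \sum_(N <= i < m) _.
set l := limn _; lra.
Qed.

Lemma blaschke_coef_cvg n : cvgn (fun m => blaschke_coef m n).
Proof.
have [N HN] := tail_sum ltr01.
apply: (@bounded_variation_cvg _ _
  ((\sum_(0 <= i < N) d i + 1) * (1 + 2 * n%:R))) => m.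
apply: (@le_trans _ _ (\sum_(i < m) d i * (1 + 2 * n%:R))).
  by apply: ler_sum => i _; exact: blaschke_coef_step.
rewrite -mulr_suml ler_wpM2r ?addr_ge0// -(big_mkord xpredT d).
have dge0 i : 0 <= d i by case/andP: (d01 i) => /ltW.
have [Nm|/ltnW mN] := leqP N m.
  by rewrite (big_cat_nat (leq0n N) Nm) /= lerD.
rewrite [X in _ <= X + _](big_cat_nat (leq0n m) mN) /=.
by rewrite -addrA lerDl addr_ge0// sumr_ge0.
Qed.

(** The Taylor coefficients at 0 of the infinite product
\prod_i (a i - z) / (1 - a i * z). *)
Definition blaschke n : R := limn (fun m => blaschke_coef m n).

Lemma blaschke_sum n : \sum_(i < n) blaschke i ^+ 2 <= 1.
Proof.
have h : (fun m => \sum_(i < n) blaschke_coef m i ^+ 2) @ \oo -->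
    \sum_(i < n) blaschke i ^+ 2.
  elim: n => [|n IH].
    by under eq_fun do rewrite big_ord0; rewrite big_ord0; exact: cvg_cst.
  under eq_fun do rewrite big_ord_recr; rewrite big_ord_recr; apply: cvgD => //=.
  under eq_fun do rewrite expr2; rewrite expr2.
  by apply: cvgM; exact: blaschke_coef_cvg.
by apply: (ler_cvg_to h (cvg_cst (1 : R))); apply: nearW => m; exact: blaschke_coef_sum.
Qed.

Lemma blaschke_approx (e : R) : 0 < e -> exists N, forall m n, (N <= m)%N ->
  `|blaschke n - blaschke_coef m n| <= e * (1 + 2 * n%:R).
Proof.
move=> e0; have [N HN] := tail_sum e0; exists N => m n Nm.
have h m' : (m <= m')%N ->
    `|blaschke_coef m' n - blaschke_coef m n| <=
    (\sum_(m <= i < m') d i) * (1 + 2 * n%:R).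
  elim: m' => [|m' IH].
    by rewrite leqn0 => /eqP ->; rewrite subrr normr0 big_geq// mul0r.
  rewrite leq_eqVlt => /orP[/eqP <-|]; first by rewrite subrr normr0 big_geq// mul0r.
  rewrite ltnS => mm'; have st := blaschke_coef_step m' n.
  set x := blaschke_coef m'.+1 n in st *.
  rewrite big_nat_recr//= mulrDl.
  have -> : x - blaschke_coef m n = (blaschke_coef m' n - blaschke_coef m n) +
    (x - blaschke_coef m' n) by ring.
  by rewrite (le_trans (ler_normD _ _))// lerD ?IH.
have cv : (fun m' => `|blaschke_coef m' n - blaschke_coef m n|) @ \oo -->
    `|blaschke n - blaschke_coef m n|.
  by apply: cvg_norm; apply: cvgB; [exact: blaschke_coef_cvg|exact: cvg_cst].
apply: (ler_cvg_to cv (cvg_cst (e * (1 + 2 * n%:R)))).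
exists m => // m' /= mm'; apply: le_trans (h _ mm') _.
rewrite ler_wpM2r ?addr_ge0//; apply: le_trans (HN m').
rewrite [leRHS](big_cat_nat Nm mm') /= lerDr sumr_ge0// => i _.
by case/andP: (d01 i) => /ltW.
Qed.

(** Bounds the effect on the value at w, |w| = r, of a change of the n-th
coefficient by at most 1 + 2n. *)
Lemma arith_geometric_sum_le (r : R) n : 0 <= r < 1 ->
  \sum_(i < n) (1 + 2 * i%:R) * r ^+ i <= 2 / (1 - r) ^+ 2.
Proof.
move=> /andP[r0 r1]; have r1' : 1 - r != 0 by rewrite subr_eq0 gt_eqF.
have -> : \sum_(i < n) (1 + 2 * i%:R) * r ^+ i =
    (1 + r - r ^+ n * ((2 * n%:R + 1) - (2 * n%:R - 1) * r)) / (1 - r) ^+ 2.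
  elim: n => [|n IH]; first rewrite big_ord0 !mulr0 expr0.
    by rewrite (_ : 1 + r - _ = 0) ?mul0r//; ring.
  by rewrite big_ord_recr /= IH -[n.+1%:R]natr1 [r ^+ n.+1]exprS; field.
rewrite ler_pM2r ?invr_gt0 ?exprn_gt0 ?subr_gt0// lerBlDr.
have h : 0 <= r ^+ n * ((2 * n%:R + 1) - (2 * n%:R - 1) * r).
  by rewrite mulr_ge0 ?exprn_ge0//; have : 0 <= n%:R :> R by []; nra.
by move: h; set x := r ^+ n * _; lra.
Qed.

Definition blaschke_factor i w := ((a i)%:C - w) / (1 - (a i)%:C * w).

Lemma psum_blaschke_coef m w : normc w < 1 ->
  ccvg (psum (blaschke_coef m) w) (\prod_(i < m) blaschke_factor i w).
Proof.
move=> w1; elim: m => [|m IH].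
  rewrite big_ord0; apply/(ccvgS (psum _ w)).
  have -> : (fun n => psum (blaschke_coef 0) w n.+1) = fun=> 1.
    apply/funext => n; rewrite /psum big_ord_recl big1 /= ?mul1r ?addr0// => i _.
    by rewrite mul0r.
  exact: ccvg_cst.
rewrite big_ord_recr /= mulrC.
exact: psum_blaschke_step (a01 m) (blaschke_coef_le1 m) w1 IH.
Qed.

(** Limit in the number of factors and sum over coefficients may be exchanged:
by [blaschke_approx] the coefficients of the m-th product differ from their
limits by at most e (1 + 2n), uniformly in n. *)
Lemma psum_blaschke_product w F : normc w < 1 -> ccvg (psum blaschke w) F ->
  ccvg (fun m => \prod_(i < m) blaschke_factor i w) F.
Proof.
move=> w1 bF; have r01 : 0 <= normc w < 1 by rewrite normc_ge0.
have r1' : 0 < 1 - normc w by rewrite subr_gt0.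
apply/cvgrPdist_le => e e0.
pose K := 2 / (1 - normc w) ^+ 2.
have K0 : 0 < K by rewrite divr_gt0// exprn_gt0.
have eK0 : 0 < e / K := divr_gt0 e0 K0.
have [N HN] := blaschke_approx eK0.
exists N => // m /= Nm; rewrite sub0r normrN ger0_norm ?normc_ge0// normc_distC.
apply: ccvg_le_norm (ccvgB bF (psum_blaschke_coef m w1)) => n.
rewrite /psum -sumrB; apply: le_trans (normc_sum _ _) _.
apply: (@le_trans _ _ (\sum_(i < n) e / K * ((1 + 2 * i%:R) * normc w ^+ i))).
  apply: ler_sum => i _; rewrite -mulrBl -rmorphB normc_mul normc_real normc_exp.
  by rewrite mulrA ler_wpM2r ?exprn_ge0 ?normc_ge0// HN.
rewrite -mulr_sumr -[leRHS](divfK (lt0r_neq0 K0) e) ler_pM2l//.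
exact: arith_geometric_sum_le.
Qed.

Lemma psum_blaschke_cvg w : normc w < 1 -> exists F, ccvg (psum blaschke w) F.
Proof.
move=> w1; have r01 : 0 <= normc w < 1 by rewrite normc_ge0.
apply: (@bounded_variation_ccvg _ _ (1 * (1 - normc w)^-1)) => n.
apply: (@le_trans _ _ (\sum_(i < n) normc w ^+ i)).
  apply: ler_sum => i _.
  rewrite /psum big_ord_recr /= addrAC subrr add0r normc_mul normc_real normc_exp.
  rewrite ler_piMl ?exprn_ge0 ?normc_ge0//.
  by apply: normr_le1_of_sum => k; exact: blaschke_sum.
rewrite ler_pdivlMr ?subr_gt0// mulrC -opprB mulNr -subrX1 opprB.
by rewrite lerBlDr lerDl exprn_ge0// normc_ge0.
Qed.

Lemma normc_one_sub i w : normc w < 1 ->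
  1 - normc w <= normc (1 - (a i)%:C * w) <= 2.
Proof.
move=> w1; have /andP[a0 a1] := a01 i.
have aw : normc ((a i)%:C * w) <= normc w.
  by rewrite normc_mul normc_real gtr0_norm// ler_piMl ?normc_ge0// ltW.
apply/andP; split.
  by apply: le_trans (normc_ge_sub _ _); rewrite normc1 lerD2l lerN2.
by apply: le_trans (normc_sub _ _) _; rewrite normc1; lra.
Qed.

(** From a - w = (1 - a w) - d (1 + w) with d = 1 - a. *)
Lemma blaschke_factor_ge i w (rho : R) : normc w <= rho -> rho < 1 ->
  1 - 2 / (1 - rho) * d i <= normc (blaschke_factor i w).
Proof.
move=> wrho rho1; have w1 := le_lt_trans wrho rho1.
have /andP[d0 d1] := d01 i; have /andP[D1 D2] := normc_one_sub i w1.
have D0 : 0 < normc (1 - (a i)%:C * w) by apply: lt_le_trans D1; rewrite subr_gt0.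
rewrite normc_mul normc_inv ler_pdivlMr//.
have -> : (a i)%:C - w = (1 - (a i)%:C * w) - (d i)%:C * (1 + w).
  by rewrite /a rmorphB /=; ring.
apply: le_trans (normc_ge_sub _ _); rewrite mulrBl mul1r lerD2l lerN2.
rewrite normc_mul normc_real gtr0_norm// [2 / _ * _]mulrC -[leRHS]mulrA ler_pM2l//.
apply: (@le_trans _ _ 2).
  by apply: le_trans (normc_add _ _) _; rewrite normc1; lra.
rewrite mulrAC ler_pdivlMr ?subr_gt0// ler_pM2l//.
by apply: le_trans D1; rewrite lerD2l lerN2.
Qed.

Lemma blaschke_factor_ge_dist i w : normc w < 1 ->
  normc ((a i)%:C - w) / 2 <= normc (blaschke_factor i w).
Proof.
move=> w1; have /andP[D1 D2] := normc_one_sub i w1.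
have D0 : 0 < normc (1 - (a i)%:C * w) by apply: lt_le_trans D1; rewrite subr_gt0.
by rewrite normc_mul normc_inv ler_wpM2l ?normc_ge0// lef_pV2 ?posrE.
Qed.

Lemma blaschke_head_ge (P : pred nat) w0 N :
  (forall i, P i -> (a i)%:C != w0) ->
  exists c r : R, [/\ 0 < c, 0 < r & forall w, normc (w - w0) < r ->
    normc w < 1 -> c <= \prod_(i < N | P i) normc (blaschke_factor i w)].
Proof.
move=> Pw0; elim: N => [|N [c [r [c0 r0 IH]]]].
  by exists 1, 1; split => // w _ _; rewrite big_ord0.
have [PN|PN] := boolP (P N); last first.
  exists c, r; split => // w wr w1.
  by rewrite big_mkcond big_ord_recr /= -big_mkcond (negPf PN) mulr1 IH.
have n0 : 0 < normc ((a N)%:C - w0) by rewrite normc_gt0 subr_eq0 Pw0.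
set q := normc _ in n0.
exists (c * (q / 4)), (Num.min r (q / 2)).
split; [by rewrite mulr_gt0// divr_gt0|by rewrite lt_min r0 divr_gt0|].
move=> w; rewrite lt_min => /andP[wr wq] w1.
rewrite big_mkcond big_ord_recr /= -big_mkcond PN.
apply: ler_pM => //; [exact: ltW|by rewrite divr_ge0// ltW|exact: IH|].
apply: le_trans (blaschke_factor_ge_dist N w1).
have := normc_sub ((a N)%:C - w) (w0 - w).
by rewrite opprB addrA subrK -/q normc_distC (normc_distC w0) -(normc_distC _ w); lra.
Qed.

(** Finitely many factors are bounded below near w0 because none of their zeros
is w0; for the others, \prod (1 - K d_i) >= 1 - K \sum d_i >= 1/2 as soon as the
sum is taken far enough in the tail. *)
Lemma blaschke_product_ge (P : pred nat) w0 : normc w0 < 1 ->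
  (forall i, P i -> (a i)%:C != w0) ->
  exists c r : R, [/\ 0 < c, 0 < r & forall w, normc (w - w0) < r ->
    normc w < 1 /\ exists N, forall m, (N <= m)%N ->
      c <= \prod_(i < m | P i) normc (blaschke_factor i w)].
Proof.
move=> w01 Pw0; pose rho := (1 + normc w0) / 2.
have rho1 : rho < 1 by rewrite /rho; lra.
pose K := 2 / (1 - rho); have K0 : 0 < K by rewrite divr_gt0// subr_gt0.
have e0 : 0 < 2^-1 / K by rewrite divr_gt0.
have [N HN] := tail_sum e0.
have [c [r [c0 r0 Hc]]] := blaschke_head_ge N Pw0.
exists (c / 2), (Num.min r ((1 - normc w0) / 2)).
split; [by rewrite divr_gt0|by rewrite lt_min r0 divr_gt0// subr_gt0|].
move=> w; rewrite lt_min => /andP[wr w0r].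
have wrho : normc w <= rho.
  by have := normc_ge_sub w w0; rewrite /rho; lra.
have w1 := le_lt_trans wrho rho1; split => //; exists N => m Nm.
have tail : 1 - K * \sum_(N <= i < m) d i <=
    \prod_(N <= i < m | P i) normc (blaschke_factor i w).
  have KS k : K * \sum_(N <= i < k) d i <= 2^-1.
    by rewrite mulrC -ler_pdivlMr.
  elim: m Nm => [|m IH].
    by rewrite leqn0 => /eqP ->; rewrite !big_geq// mulr0 subr0.
  rewrite leq_eqVlt => /orP[/eqP <-|]; first by rewrite !big_geq// mulr0 subr0.
  rewrite ltnS => Nm; have := KS m.+1; rewrite big_nat_recr//= => KS1.
  have dm0 : 0 < K * d m by rewrite mulr_gt0//; case/andP: (d01 m).
  rewrite [X in _ <= X]big_mkcond big_nat_recr//= -big_mkcond /=.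
  have IHm := IH Nm; have KSm := KS m.
  set p := \prod_(N <= i < m | _) _ in IHm *.
  set s := \sum_(N <= i < m) _ in IHm KSm KS1 *.
  rewrite mulrDr in KS1 *.
  have fm : 1 - K * d m <= (if P m then normc (blaschke_factor m w) else 1).
    case: (P m); last by lra.
    exact: blaschke_factor_ge.
  set f := (if _ then _ else _) in fm *.
  have s0 : 0 <= K * s.
    by rewrite mulr_ge0 ?(ltW K0)// sumr_ge0// => i _; case/andP: (d01 i) => /ltW.
  move: (K * s) (K * d m) s0 IHm KSm KS1 dm0 fm => x y x0 px x2 xy y0 fy.
  have xy0 : 0 <= x * y by rewrite mulr_ge0// ltW.
  apply: (@le_trans _ _ ((1 - x) * (1 - y))).
    by rewrite mulrBr mulr1 mulrBl mul1r; lra.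
  by apply: ler_pM => //; lra.
rewrite -(big_mkord P (fun i => normc (blaschke_factor i w))).
rewrite (big_cat_nat (leq0n N) Nm) /=; apply: ler_pM => //; first exact: ltW.
  by rewrite big_mkord; exact: Hc.
apply: le_trans tail.
have : K * \sum_(N <= i < m) d i <= 2^-1 by rewrite mulrC -ler_pdivlMr.
by move: (K * _) => x; lra.
Qed.

Lemma blaschke0_neq0 : blaschke 0 != 0.
Proof.
have n01 : normc (0 : R[i]) < 1 by rewrite normc0.
have [i _|c [r [c0 r0 H]]] := @blaschke_product_ge predT 0 n01.
  by rewrite -normc_gt0 normc_real normr_gt0 gt_eqF//; case/andP: (a01 i).
have [|_ [N HN]] := H 0; first by rewrite subrr normc0.
have b0 : ccvg (psum blaschke 0) (blaschke 0)%:C.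
  apply/(ccvgS (psum _ 0)).
  have -> : (fun n => psum blaschke 0 n.+1) = fun=> (blaschke 0)%:C.
    apply/funext => n; rewrite /psum big_ord_recl big1 /= ?mulr1 ?addr0// => i _.
    by rewrite expr0n mulr0.
  exact: ccvg_cst.
have := psum_blaschke_product n01 b0.
move=> /(@ccvg_norm_ge _ _ _ c N) h.
have : c <= normc (blaschke 0)%:C.
  by apply: h => n Nn; rewrite (normc_prod n (blaschke_factor^~ 0)); exact: HN.
by rewrite normc_real => cb; rewrite -normr_gt0 (lt_le_trans c0).
Qed.

Lemma blaschke_zero j : ccvg (psum blaschke (a j)%:C) 0.
Proof.
have aj1 : normc (a j)%:C < 1.
  by have /andP[? ?] := a01 j; rewrite normc_real gtr0_norm.
have [F bF] := psum_blaschke_cvg aj1.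
have pF := psum_blaschke_product aj1 bF.
suff <- : F = 0 by [].
apply: (ccvg_unique pF); apply/cvgrPdist_le => e e0.
exists j.+1 => // m /= jm; rewrite (bigD1 (Ordinal jm))//=.
by rewrite /blaschke_factor subrr !mul0r subrr normc0 subrr normr0 ltW.
Qed.

Lemma blaschke_simple_zero j : exists c r : R, [/\ 0 < c, 0 < r &
  forall w F, normc (w - (a j)%:C) < r -> ccvg (psum blaschke w) F ->
    c * normc (w - (a j)%:C) <= normc F].
Proof.
have aj1 : normc (a j)%:C < 1.
  by have /andP[? ?] := a01 j; rewrite normc_real gtr0_norm.
have [i ij|c [r [c0 r0 H]]] := @blaschke_product_ge (predC1 j) (a j)%:C aj1.
  rewrite -subr_eq0 -rmorphB -normc_eq0 normc_real normr_eq0 /a.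
  rewrite opprB addrC addrA subrK subr_eq0.
  by apply: contraNneq ij => /d_inj ->; rewrite /= eqxx.
exists (c / 2), r; split => //; first by rewrite divr_gt0.
move=> w F wr bF; have [w1 [N HN]] := H w wr.
apply: (@ccvg_norm_ge _ _ _ _ (maxn N j.+1) _ (psum_blaschke_product w1 bF)) => n.
rewrite geq_max => /andP[Nn jn].
rewrite (normc_prod n (blaschke_factor^~ w)) (bigD1 (Ordinal jn))//=.
rewrite (_ : c / 2 * _ = normc (w - (a j)%:C) / 2 * c); last by field.
apply: ler_pM; [|exact: ltW| |].
- by rewrite divr_ge0 ?normc_ge0.
- by apply: le_trans (blaschke_factor_ge_dist j w1); rewrite normc_distC.
- exact: HN.
Qed.

End BlaschkeProduct.

(** * The choice of the zeros *)
Section Exponent.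
Context {R : realType}.

Lemma ln_succ_sub (n : nat) :
  (n.+2%:R)^-1 <= ln (n.+2%:R : R) - ln (n.+1%:R : R).
Proof.
have n1 : 0 < (n.+1%:R : R) by rewrite ltr0n.
have n2 : 0 < (n.+2%:R : R) by rewrite ltr0n.
rewrite -opprB lerNr -ln_div ?posrE//.
have -> : n.+1%:R / n.+2%:R = 1 + - (n.+2%:R)^-1 :> R.
  by rewrite -[n.+2%:R]natr1 in n2 *; field; rewrite gt_eqF.
by apply: le_ln1Dx; rewrite ltrN2 invf_lt1// ltr1n.
Qed.

(** Take d_i = (i + 2)^(- 1/g), so that d_i^g = 1 / (i + 2).  Its sum is
controlled by telescoping: with e = 1/g - 1 > 0 the difference
(i + 1)^(-e) - (i + 2)^(-e) is at least e d_i. *)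
Lemma critical_sequence (g : R) : 0 < g < 1 -> exists d : nat -> R,
  [/\ forall i, 0 < d i < 1, injective d, cvgn (series d) &
      forall i, g * ln (d i) = - ln (i.+2%:R)].
Proof.
move=> /andP[g0 g1]; pose s := g^-1; pose e := s - 1.
have e0 : 0 < e by rewrite subr_gt0 invf_gt1.
have s0 : 0 < s by rewrite invr_gt0.
have L0 i : 0 < ln (i.+2%:R : R) by rewrite ln_gt0// ltr1n.
exists (fun i => expR (- s * ln i.+2%:R)); split.
- by move=> i; rewrite expR_gt0 -[X in _ < X]expR0 ltr_expR mulNr oppr_lt0 mulr_gt0.
- move=> i j /expR_inj /(mulfI _) h.
  have := h; rewrite oppr_eq0 gt_eqF// => /(_ isT) /ln_inj.
  by rewrite !posrE !ltr0n => /(_ isT isT) /eqP; rewrite eqr_nat => /eqP [].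
- apply: nondecreasing_is_cvgn.
    apply/nondecreasing_seqP => n.
    by rewrite !seriesEnat /= big_nat_recr//= lerDl ltW// expR_gt0.
  exists e^-1 => _ [n _ <-]; rewrite seriesEnat /=.
  pose x i := expR (- e * ln (i.+1%:R : R)).
  have step i : expR (- s * ln i.+2%:R) <= e^-1 * (x i - x i.+1).
    rewrite ler_pdivlMl// lerBrDr.
    have -> : expR (- s * ln (i.+2%:R : R)) = x i.+1 * (i.+2%:R)^-1.
      rewrite /x -[X in _ * X^-1](@lnK R) ?posrE ?ltr0n// -expRN -expRD.
      by congr expR; rewrite /e; ring.
    have -> : x i = x i.+1 * expR (e * (ln i.+2%:R - ln i.+1%:R)).
      by rewrite /x -expRD; congr expR; ring.
    apply: (@le_trans _ _ (x i.+1 * (1 + e * (ln i.+2%:R - ln i.+1%:R)))).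
      rewrite mulrDr mulr1 addrC lerD2l mulrCA ler_pM2l ?expR_gt0// ler_pM2l//.
      exact: ln_succ_sub.
    by rewrite ler_pM2l ?expR_gt0// expR_ge1Dx.
  apply: (@le_trans _ _ (\sum_(0 <= i < n) e^-1 * (x i - x i.+1))).
    by apply: ler_sum => i _; exact: step.
  rewrite -mulr_sumr -[leRHS]mulr1 ler_pM2l ?invr_gt0//.
  under eq_bigr do rewrite -opprB.
  rewrite sumrN telescope_sumr// opprB /x ln1 mulr0 expR0 lerBlDr lerDl.
  exact: expR_ge0.
- by move=> i; rewrite expRK /s; field; rewrite gt_eqF.
Qed.

End Exponent.

(** * The summand at a real eigenvalue *)
Section Weight.
Context {R : realType}.

Lemma dist_segment_real (l : R) : 2 <= l -> dist_segment l%:C = l - 2.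
Proof.
move=> l2; apply/eqP; rewrite eq_le; apply/andP; split.
  apply: ge_inf.
    exists (l - 2) => _ [x xI <-].
have /andP[_ x2] : -2 <= x <= 2 by move: xI; rewrite /= in_itv.
    rewrite -rmorphB normc_real; apply: le_trans (ler_norm _).
    by rewrite lerD2l lerN2.
  exists 2; first by rewrite /= in_itv /= lexx andbT; lra.
  by rewrite -rmorphB normc_real ger0_norm// subr_ge0.
apply: lb_le_inf.
  exists (normc (l%:C - 2%:C)), 2 => //.
  by rewrite /= in_itv /= lexx andbT; lra.
move=> _ [x xI <-].
have /andP[_ x2] : -2 <= x <= 2 by move: xI; rewrite /= in_itv.
rewrite -rmorphB normc_real; apply: le_trans (ler_norm _).
by rewrite lerD2l lerN2.
Qed.

Definition weight (gamma : R) (l : R[i]) : R :=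
  dist_segment l `^ gamma /
    (normc (l + 2) `^ (gamma / 2) * normc (l - 2) `^ (gamma / 2)).

(** With a = 1 - d one has l - 2 = (1 - a)^2 / a and l + 2 = (1 + a)^2 / a, so
the summand is (d / (2 - d))^gamma.  The base is at most 1 and at least d / 2,
which allows gamma to be raised to g, and 2^-g is at least 1/2. *)
Lemma weight_ge (gamma g d y : R) : gamma <= g -> 0 < g <= 1 -> 0 < d < 1 ->
  0 < y -> g * ln d = - ln y ->
  (2 * y)^-1 <= weight gamma (joukowski (1 - d)%:C).
Proof.
move=> gg /andP[g0 g1] /andP[d0 d1] y0 dy; set a := 1 - d.
have a0 : 0 < a by rewrite subr_gt0.
pose l := a + a^-1.
have lE : joukowski a%:C = l%:C.
  by rewrite /joukowski /l (rmorphD (real_complex R) a) fmorphV.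
pose p := d ^+ 2 / a; pose q := (2 - d) ^+ 2 / a.
have p0 : 0 < p by rewrite divr_gt0// exprn_gt0.
have d2 : 0 < 2 - d by lra.
have q0 : 0 < q by rewrite divr_gt0// exprn_gt0.
have a_neq0 : 1 - d != 0 by rewrite gt_eqF.
have lp : l - 2 = p by rewrite /l /p /a; field.
have lq : l + 2 = q by rewrite /l /q /a; field.
have two : (2 : R[i]) = (2 : R)%:C by rewrite rmorphMn.
rewrite /weight lE dist_segment_real; last by rewrite -subr_ge0 lp ltW.
rewrite two -rmorphD -rmorphB !normc_real lp lq !gtr0_norm//.
rewrite /powR (gt_eqF p0) (gt_eqF q0) -expRD -expRN -expRD.
have -> : (2 * y)^-1 = expR (- ln 2 + g * ln d).
  by rewrite dy -opprD -lnM ?posrE// expRN lnK// posrE mulr_gt0.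
rewrite ler_expR.
have lnp : ln p = 2 * ln d - ln a by rewrite ln_div ?posrE ?exprn_gt0// lnXn// mulr_natl.
have lnq : ln q = 2 * ln (2 - d) - ln a.
  by rewrite ln_div ?posrE ?exprn_gt0// lnXn// mulr_natl.
rewrite lnp lnq.
have h1 : ln d <= ln (2 - d) by rewrite ler_ln ?posrE//; lra.
have h2 : ln (2 - d) <= ln 2 by rewrite ler_ln ?posrE//; lra.
have h3 : 0 < ln 2 :> R by rewrite ln_gt0// ltr1n.
have -> : gamma * (2 * ln d - ln a) + - (gamma / 2 * (2 * ln (2 - d) - ln a) +
   gamma / 2 * (2 * ln d - ln a)) = - (gamma * (ln (2 - d) - ln d)) by field.
have h4 : gamma * (ln (2 - d) - ln d) <= g * (ln (2 - d) - ln d).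
  by rewrite ler_wpM2r// subr_ge0.
have h5 : g * ln (2 - d) <= g * ln 2 by rewrite ler_pM2l.
have h6 : g * ln 2 <= ln 2 by rewrite ler_piMl// ltW.
lra.
Qed.

Lemma esum_harmonic_infty (T : choiceType) (D : set T) (t : T -> R)
    (l : nat -> T) (c : R) : 0 < c -> injective l -> (forall i, D (l i)) ->
  (forall i, c * harmonic i <= t (l i)) ->
  (\esum_(x in D) (t x)%:E = +oo)%E.
Proof.
move=> c0 linj lD tl.
have lb n : ((\sum_(0 <= i < n) t (l i))%:E <= \esum_(x in D) (t x)%:E)%E.
  apply: esum_ge; exists [set` map l (index_iota 0 n)].
    split; first exact: finite_seq.
    by move=> _ /= /mapP[i _ ->].
  by rewrite -fsbig_seq ?map_inj_uniq ?iota_uniq// big_map sumEFin.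
case E : (\esum_(x in D) (t x)%:E)%E lb => [v| |] lb //; last first.
  by have := lb 0%N; rewrite leNgt ltNyr.
exfalso; apply: (@dvg_harmonic R); apply: nondecreasing_is_cvgn.
  apply/nondecreasing_seqP => n.
  by rewrite !seriesEnat /= big_nat_recr//= lerDl harmonic_ge0.
exists (c^-1 * v) => _ [n _ <-]; rewrite seriesEnat /= ler_pdivlMl//.
apply: (@le_trans _ _ (\sum_(0 <= i < n) t (l i))); last by rewrite -lee_fin lb.
by rewrite mulr_sumr; apply: ler_sum => i _; exact: tl.
Qed.

End Weight.

(** * The perturbation with prescribed eigenvalues *)
Section Secular.
Context {R : realType}.
Variable d : nat -> R.
Hypothesis d01 : forall i, 0 < d i < 1.
Hypothesis d_inj : injective d.
Hypothesis d_sum : cvgn (series d).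

Let f := blaschke d.
Let f0 : f 0%N != 0. Proof. exact: blaschke0_neq0. Qed.

(** Chosen so that w^2 - 1 + w \sum_k b_k w^k is the Blaschke product divided by
- f 0, which makes its constant term -1; the correction at index 1 cancels the
summand w^2. *)
Definition secular_weight i : R := - (f i.+1 / f 0%N) - (i == 1%N)%:R.

Lemma secular_weight_sum n :
  \sum_(i < n) secular_weight i ^+ 2 <= 2 / f 0%N ^+ 2 + 2.
Proof.
have f02 : 0 < f 0%N ^+ 2 by rewrite exprn_even_gt0.
apply: (@le_trans _ _ (\sum_(i < n)
    (2 / f 0%N ^+ 2 * f i.+1 ^+ 2 + 2 * (i == 1%N :> nat)%:R))).
  apply: ler_sum => i _; rewrite -subr_ge0 /secular_weight.
  have : 0 <= (f i.+1 / f 0%N - (i == 1%N :> nat)%:R) ^+ 2 by exact: sqr_ge0.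
  have -> : 2 / f 0%N ^+ 2 * f i.+1 ^+ 2 = 2 * (f i.+1 / f 0%N) ^+ 2 by field.
  by case: (_ == 1%N) => /=; move: (f i.+1 / _) => x; nra.
rewrite big_split /= lerD//.
  rewrite -mulr_sumr ler_piMr// ?divr_ge0 ?sqr_ge0//.
  have := blaschke_sum d01 d_sum n.+1; rewrite big_ord_recl /= => h.
  by apply: le_trans h; rewrite lerDr sqr_ge0.
rewrite -mulr_sumr ler_piMr//.
case: (ltnP 1 n) => n1.
  rewrite (bigD1 (Ordinal n1)) //= big1 ?addr0// => i; rewrite -val_eqE /=.
  by case: (_ == _).
rewrite big1// => i _; case: eqP => // i1.
by have := ltn_ord i; rewrite i1 => /leq_trans/(_ n1).
Qed.

(** The secular equation: by [green_function], ell(g) is the power series of the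
b_k divided by w - 1/w. *)
Lemma psum_secular (ell : {scalar l2 R}) (w : R[i]) (g : l2 R) :
  0 < normc w < 1 ->
  (forall u : l2 R,
    ccvg (fun n => \sum_(i < n) (secular_weight i)%:C * u i%:Z) (ell u)) ->
  free_schrodinger g - joukowski w *: g = delta0 ->
  ccvg (psum f w) (- (f 0%N)%:C * (w ^+ 2 - 1) * (1 + ell g)).
Proof.
move=> w01 ellE gE; have w0 : w != 0 by rewrite -normc_gt0; case/andP: w01.
have n0 : w - w^-1 != 0.
  apply/eqP => /eqP; rewrite subr_eq0 => /eqP /(congr1 (@normc R)).
  rewrite normc_inv => e; case/andP: w01 => nw0 nw1.
  have := divff (lt0r_neq0 nw0); rewrite -e => h; clear ellE gE; nra.
pose x n := \sum_(i < n) (secular_weight i)%:C * g i%:Z.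
(* At least two terms are taken so that the correction at index 1 is present. *)
apply/(ccvgS (psum f w))/(ccvgS (fun n => psum f w n.+1)).
apply/(ccvgS (fun n => psum f w n.+2)).
have -> : (fun n => psum f w n.+3) =
    (fun n => (f 0%N)%:C * (1 - w ^+ 2) + - (f 0%N)%:C * (w ^+ 2 - 1) * x n.+2).
  apply/funext => n.
  have xE m : (w ^+ 2 - 1) * x m = \sum_(i < m) (secular_weight i)%:C * w ^+ i.+1.
    rewrite /x mulr_sumr; apply: eq_bigr => i _; rewrite (green_function _ w01 gE).
    have -> : w ^+ 2 - 1 = w * (w - w^-1) by field.
    by rewrite exprS; set q := w - w^-1 in n0 *; field.
  have fE i : (f i.+1)%:C = - (f 0%N)%:C * ((secular_weight i)%:C + (i == 1%N)%:R).
    have -> : f i.+1 = - f 0%N * (secular_weight i + (i == 1%N)%:R).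
      by rewrite /secular_weight; field.
    by rewrite rmorphM rmorphN (rmorphD (real_complex R) (secular_weight i)) rmorph_nat.
  rewrite -mulrA xE /psum big_ord_recl expr0 mulr1.
  under eq_bigr do rewrite lift0 fE -mulrA mulrDl.
  rewrite -mulr_sumr big_split /=.
  have -> : \sum_(i < n.+2) (i == 1%N :> nat)%:R * w ^+ i.+1 = w ^+ 2.
    rewrite !big_ord_recl big1 /= ?addr0 => [|i _]; last by rewrite mul0r.
    by rewrite mul0r mul1r add0r.
  by ring.
have -> : - (f 0%N)%:C * (w ^+ 2 - 1) * (1 + ell g) =
  (f 0%N)%:C * (1 - w ^+ 2) + - (f 0%N)%:C * (w ^+ 2 - 1) * ell g by ring.
apply: ccvgD; first exact: ccvg_cst.
by apply: ccvgZ; apply/(ccvgS (fun n => x n.+1))/(ccvgS x); exact: ellE.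
Qed.

End Secular.

Unset Implicit Arguments.

Theorem proposition2 (R : realType) (gamma : R) (hgamma : gamma < 1) :
  exists M : {linear l2 R -> l2 R},
    let B : {linear l2 R -> l2 R} := (free_schrodinger \+ M)%R in
    [/\ bounded_op M, rank_one M &
      (\esum_(l in discrete_spectrum B)
        ((alg_mult B l)%:R *
         (dist_segment l `^ gamma /
          (normc (l + 2) `^ (gamma / 2) * normc (l - 2) `^ (gamma / 2))))%:E
       = +oo)%E].
Proof.
(* For gamma <= 0 any summable sequence of zeros would do; raising the exponent
   to at least 1/2 covers this case without a separate argument. *)
pose g := Num.max gamma 2^-1.
have gg : gamma <= g by rewrite le_max lexx.
have g01 : 0 < g < 1.
  by rewrite lt_max gt_max hgamma invr_gt0 ltr0n orbT /= invf_lt1// ltr1n.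
have [d [d01 d_inj d_sum dE]] := critical_sequence g01.
have f0 : blaschke d 0 != 0 by exact: blaschke0_neq0.
have f02 : 0 < blaschke d 0 ^+ 2 by rewrite exprn_even_gt0.
pose beta := 2 / blaschke d 0 ^+ 2 + 2.
have beta0 : 0 < beta by rewrite addr_gt0// divr_gt0.
have [ell [ellE ell_bounded]] :=
  pairing_exists beta0 (secular_weight_sum d01 d_sum).
exists (rank_one_map ell).
set B : {linear l2 R -> l2 R} := (_ \+ _)%R => /=.
pose a i : R[i] := (1 - d i)%:C.
have a01 i : 0 < normc (a i) < 1.
  have /andP[d0 d1] := d01 i.
  by rewrite normc_real gtr0_norm ?subr_gt0// d1 /= gtrDl oppr_lt0.
have psumE w u : 0 < normc w < 1 -> free_schrodinger u - joukowski w *: u = delta0 ->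
    ccvg (psum (blaschke d) w)
      (- (blaschke d 0)%:C * (w ^+ 2 - 1) * (1 + ell u)).
  by move=> w01; exact: psum_secular.
have D0 i u : free_schrodinger u - joukowski (a i) *: u = delta0 -> 1 + ell u = 0.
  move=> uE; have n0 : a i ^+ 2 - 1 != 0.
    rewrite subr_eq0; apply/eqP => /(congr1 (@normc R)).
    rewrite normc_exp normc1 => e; case/andP: (a01 i) => h1 h2; clear uE; nra.
  have := ccvg_unique (psumE _ _ (a01 i) uE) (blaschke_zero d01 d_sum i).
  move=> /eqP; rewrite !mulf_eq0 oppr_eq0 (negPf n0) orbF -normc_eq0 normc_real.
  by rewrite normr_eq0 (negPf f0) => /eqP.
have eig i : discrete_spectrum B (joukowski (a i)) /\
    (1 <= alg_mult B (joukowski (a i)))%N.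
  have [u uE] := free_resolvent_surj delta0 (a01 i).
  have [c [r [c0 r0 H]]] := blaschke_simple_zero d01 d_inj d_sum i.
  have nf0 : 0 < `|blaschke d 0| by rewrite normr_gt0.
  apply: (simple_zero_eigenvalue ell_bounded
    (c := c / (2 * `|blaschke d 0|)) (a01 i) uE (D0 i u uE) _ r0).
    by rewrite divr_gt0// mulr_gt0.
  move=> w' u' w'r w'01 u'E.
  have := H w' _ w'r (psumE _ _ w'01 u'E).
  rewrite !normc_mul normc_opp normc_real => h.
  rewrite mulrAC ler_pdivrMr ?mulr_gt0//; apply: le_trans h _.
  rewrite [leRHS]mulrC ler_wpM2r ?normc_ge0// mulrC ler_pM2r//.
  apply: le_trans (normc_sub _ _) _; rewrite normc1 normc_exp.
  rewrite lerD2r expr_le1 ?normc_ge0//.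
  by case/andP: w'01 => _ /ltW.
have [u uE] := free_resolvent_surj delta0 (a01 0%N).
split.
- exact: bounded_rank_one_map ell_bounded.
- apply: (@rank_one_rank_one_map _ _ u).
  apply/eqP => u0; move/eqP: (D0 _ _ uE).
  by rewrite u0 addr0 oner_eq0.
- apply: (@esum_harmonic_infty _ _ _ _ (fun i => joukowski (a i)) (2^-1 / 2)).
  + by rewrite divr_gt0.
  + move=> i j /(joukowski_inj (a01 i) (a01 j)).
    by rewrite /a => /(congr1 (@complex.Re R)) /= /addrI /oppr_inj /d_inj.
  + by move=> i; case: (eig i).
  + move=> i; have [_ mult] := eig i.
    have g01' : 0 < g <= 1 by case/andP: g01 => -> /ltW ->.
    have i2 : 0 < (i.+2%:R : R) by rewrite ltr0n.
    have := weight_ge gg g01' (d01 i) i2 (dE i); rewrite -/(a i) => wge.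
    apply: le_trans (le_trans wge _).
      rewrite /harmonic -!invfM lef_pV2 ?posrE ?mulr_gt0// -mulrA ler_pM2l//.
      by rewrite -natrM ler_nat mul2n -addnn !addSn addnS !ltnS leq_addr.
    rewrite -/(weight _ _) ler_peMl ?ler1n//.
    by apply: le_trans wge; rewrite invr_ge0 mulr_ge0// ltW.
Qed.
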